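(* Let $a,b>0$, let $g\in L^2(\mathbb R)$ be such that $\mathcal G=(E_{mb}T_{na}g)_{m,n\in\mathbb Z}$ is a frame for $L^2(\mathbb R)$, and let $\mathcal G^d=(E_{mb}T_{na}g^d)_{m,n\in\mathbb Z}$ (with $g^d\in L^2(\mathbb R)$) be an arbitrary dual Gabor frame of $\mathcal G$. Suppose also that $\mathcal A$ is a bounded operator on $L^2(\mathbb R)$ such that $\|Id_{L^2(\mathbb R)}-\mathcal A\|<1$ and $\mathcal A$ commutes with $E_{\pm b}$ and $T_{\pm a}$. Then the family $\mathcal G^{ad}=(E_{mb}T_{na}g^{ad})_{m,n\in\mathbb Z}$, where $$g^{ad}=\mathcal A^*S_{\mathcal G}^{-1}g-g+S_{\mathcal G}(g^d),$$ is an approximately dual frame of $\mathcal G$ for which $T_{\mathcal G}U_{\mathcal G^{ad}}=\mathcal A$.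
   Context: For $c\in\mathbb R$, $T_cf(x)=f(x-c)$ and $E_cf(x)=e^{2\pi i c x}f(x)$ on $L^2(\mathbb R)$; $Id_{L^2(\mathbb R)}$ is the identity. A countable family $\Phi=(\varphi_k)_{k\in I}$ in a Hilbert space $\mathcal H$ is a frame if there are constants $m,M>0$ with $m\|f\|^2\le\sum_{k}|\langle f,\varphi_k\rangle|^2\le M\|f\|^2$ for all $f\in\mathcal H$; it is a Bessel sequence if the second inequality holds. For a Bessel sequence: the analysis operator is $U_\Phi:\mathcal H\to\ell^2(I)$, $U_\Phi f=(\langle f,\varphi_k\rangle)_k$; the synthesis operator is $T_\Phi:\ell^2(I)\to\mathcal H$, $T_\Phi((c_k)_k)=\sum_k c_k\varphi_k$; the frame operator is $S_\Phi=T_\Phi U_\Phi$, invertible if $\Phi$ is a frame. Here these are used with $\mathcal H=L^2(\mathbb R)$ and $I=\mathbb Z^2$, so $S_{\mathcal G}f=\sum_{m,n\in\mathbb Z}\langle f,E_{mb}T_{na}g\rangle E_{mb}T_{na}g$. The frame $\mathcal G^d$ is a dual Gabor frame of $\mathcal G$ if $f=\sum_{m,n\in\mathbb Z}\langle f,E_{mb}T_{na}g^d\rangle E_{mb}T_{na}g$ for all $f\in L^2(\mathbb R)$. Two Bessel sequences $\Phi,\Psi$ are approximately dual frames if $\|Id_{\mathcal H}-T_\Phi U_\Psi\|<1$ or $\|Id_{\mathcal H}-T_\Psi U_\Phi\|<1$ (equivalent conditions, by taking adjoints). *)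

(* Defs.v *)
From HB Require Import structures.
From mathcomp Require Import all_boot all_order all_algebra complex.
From mathcomp Require Import sesquilinear generic_quotient ring_quotient ring.
From mathcomp Require Import all_classical all_reals all_analysis.
From mathcomp Require Import measurable_realfun.
From mathcomp.analysis Require summability.

Set Implicit Arguments.
Unset Strict Implicit.
Unset Printing Implicit Defensive.
Import Order.TTheory GRing.Theory Num.Theory.
Import numFieldNormedType.Exports.
Import ComplexField.Normc.

Local Open Scope classical_set_scope.
Local Open Scope ring_scope.
Local Open Scope quotient_scope.

Section inner_product_norm.
Context (C : numClosedFieldType) (V : lmodType C).
Variable dot : {dot V for Num.conj : C -> C}.

Lemma dot_ge0 u : 0 <= dot u u.
Proof.
have [->|u0] := eqVneq u 0; last exact/ltW/(neq0_dnorm_gt0 (s := dot)).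
by rewrite linear0l.
Qed.

Lemma dotC u v : dot v u = Num.conj (dot u v).
Proof. by rewrite (hermC dot) expr0 mul1r. Qed.

Lemma dot_CauchySchwarz u v : `|dot u v| ^+ 2 <= dot u u * dot v v.
Proof.
have [->|v0] := eqVneq v 0; first by rewrite !raddf0 normr0 expr0n mulr0.
have vv : 0 < dot v v by exact: (neq0_dnorm_gt0 (s := dot)).
have := dot_ge0 (dot v v *: u - dot u v *: v).
rewrite linearBl !linearB/= !linearZl_LR/= !linearZ/= (dotC u v).
rewrite (conj_Creal (gtr0_real vv)) normCK.
set n := dot v v in vv *; set c := dot u v; set c' := Num.conj c.
rewrite [X in 0 <= X](_ : _ = n * (dot u u * n - c * c')).
  by rewrite pmulr_rge0// subr_ge0.
by rewrite /GRing.scale/=; ring.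
Qed.

Definition ip_norm u := sqrtC (dot u u).

Lemma ip_norm_ge0 u : 0 <= ip_norm u. Proof. by rewrite sqrtC_ge0 dot_ge0. Qed.

Lemma ip_normD u v : ip_norm (u + v) <= ip_norm u + ip_norm v.
Proof.
rewrite -(@ler_pXn2r _ 2)// ?nnegrE ?addr_ge0 ?ip_norm_ge0// sqrrD !sqrtCK.
have -> : dot (u + v) (u + v) =
    dot u u + (dot u v + Num.conj (dot u v)) + dot v v.
  by rewrite linearDl !linearD/= -(dotC u v) !addrA.
rewrite lerD2r lerD2l.
have CS : `|dot u v| <= ip_norm u * ip_norm v.
  rewrite -(@ler_pXn2r _ 2)// ?nnegrE ?mulr_ge0 ?ip_norm_ge0// exprMn !sqrtCK.
  exact: dot_CauchySchwarz.
rewrite -mulr_natr -ler_pdivrMr// -ReE; apply: le_trans CS.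
exact: (leif_Re_Creal (dot u v)).1.
Qed.

Lemma ip_normZ a u : ip_norm (a *: u) = `|a| * ip_norm u.
Proof.
rewrite /ip_norm linearZl_LR/= linearZ/= mulrA -normCK.
by rewrite sqrtCM ?nnegrE ?exprn_ge0 ?dot_ge0// sqrCK.
Qed.

Lemma ip_norm0_eq0 u : ip_norm u = 0 -> u = 0.
Proof.
move=> /eqP; rewrite sqrtC_eq0; apply: contraTeq => u0.
by rewrite gt_eqF//; exact: (neq0_dnorm_gt0 (s := dot)).
Qed.

End inner_product_norm.

(* Complex inner product spaces: normed spaces over R[i] whose norm comes from
   an inner product, linear in its first argument and conjugate-linear in the
   second one. Completeness is not part of the structure: none of the notions
   below needs it to be stated. *)
HB.mixin Record NormedModule_isInnerProductSpace (R : realType) H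
    & NormedModule R[i] H := {
  inner : {dot H for (Num.conj : R[i] -> R[i])};
  inner_normE : forall x : H, `|x| ^+ 2 = inner x x
}.

#[short(type="innerProductType")]
HB.structure Definition InnerProductSpace (R : realType) :=
  {H of NormedModule R[i] H & NormedModule_isInnerProductSpace R H}.

Section frames.
Context (R : realType) (H : innerProductType R) (I : countType).
Implicit Types (phi psi : I -> H) (A : H -> H).

(* The norm `|x| of a normed module over R[i] lives in R[i]; this is the same
   number as an element of R. *)
Definition hnorm (x : H) : R := complex.Re `|x|.

Definition bounded_operator A :=
  exists M : R, forall x, hnorm (A x) <= M * hnorm x.

Definition opnorm A : \bar R :=
  ereal_sup [set (hnorm (A x))%:E | x in [set x | hnorm x <= 1]].

(* adjoint A y is the only z such that <A x, y> = <x, z> for all x; it exists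
   when H is complete and A is a bounded linear operator (and it is 0 when no
   such z exists). *)
Definition adjoint A (y : H) : H :=
  get [set z | forall x, inner (A x) y = inner x z].

Definition coef_energy phi (f : H) : \bar R :=
  \esum_(k in [set: I]) (normc (inner f (phi k)) ^+ 2)%:E.

Definition bessel phi := exists M : R,
  0 < M /\ forall f : H, (coef_energy phi f <= (M * hnorm f ^+ 2)%:E)%E.

Definition frame phi := exists m M : R, [/\ 0 < m, 0 < M &
  forall f : H, ((m * hnorm f ^+ 2)%:E <= coef_energy phi f
                 <= (M * hnorm f ^+ 2)%:E)%E].

Definition analysis phi (f : H) : I -> R[i] := fun k => inner f (phi k).

(* The series is the limit in H of the finite partial sums, along the directed
   set of finite subsets of I (unconditional convergence). For a Bessel
   sequence phi, it converges for all square-summable c. *)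
Definition synthesis phi (c : I -> R[i]) : H :=
  summability.sum (fun k => c k *: phi k).

Definition frame_operator phi (f : H) : H := synthesis phi (analysis phi f).

(* 'pinv_ picks preimages, hence this is the inverse of the frame operator
   whenever the latter is bijective, which is the case for a frame in a complete
   space. *)
Definition frame_operator_inv phi : H -> H :=
  'pinv_(fun=> 0) [set: H] (frame_operator phi).

(* psi is a dual frame of phi. *)
Definition dual_frame phi psi := frame psi /\
  forall f, f = synthesis phi (analysis psi f).

Definition approximately_dual phi psi := [/\ bessel phi, bessel psi &
  (opnorm (fun f => (f - synthesis phi (analysis psi f))%R) < 1)%E \/
  (opnorm (fun f => (f - synthesis psi (analysis phi f))%R) < 1)%E].

End frames.

(* L^2(mu) for complex-valued functions, as the quotient of the square-
   integrable functions (L2fun) by the almost everywhere null ones. R[i] carries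
   no sigma-algebra in the library: measurability is that of the real and
   imaginary parts. *)
Section L2fun.
Context d (T : measurableType d) (R : realType).
Variable mu : {measure set T -> \bar R}.

Definition L2fun_pred : {pred T -> R[i]} := mem [set f : T -> R[i] |
  [/\ measurable_fun setT (fun x => complex.Re (f x)),
      measurable_fun setT (fun x => complex.Im (f x)) &
      (\int[mu]_x (normc (f x) ^+ 2)%:E < +oo)%E]].

Lemma L2fun_memP (f : T -> R[i]) : f \in L2fun_pred <->
  [/\ measurable_fun setT (fun x => complex.Re (f x)),
      measurable_fun setT (fun x => complex.Im (f x)) &
      (\int[mu]_x (normc (f x) ^+ 2)%:E < +oo)%E].
Proof. by rewrite inE. Qed.

Lemma normc_sqr (z : R[i]) :
  normc z ^+ 2 = complex.Re z ^+ 2 + complex.Im z ^+ 2.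
Proof. by case: z => x y; rewrite /normc /= sqr_sqrtr ?addr_ge0 ?sqr_ge0. Qed.

Lemma Lfun2P (h : T -> R) : h \in Lfun mu 2%:E <->
  measurable_fun setT h /\ (\int[mu]_x (h x ^+ 2)%:E < +oo)%E.
Proof.
split=> [hL|[mh hoo]].
  split; first by move: hL; rewrite inE => /andP[]; rewrite inE.
  have /integrableP[_] := Lfun2_integrable_sqr hL.
  by under eq_integral do rewrite /= ger0_norm ?sqr_ge0//.
rewrite inE; apply/andP; split; rewrite inE//= /finite_norm unlock.
rewrite poweR_lty//; apply: le_lt_trans hoo.
rewrite le_eqVlt; apply/orP; left; apply/eqP/eq_integral => x _ /=.
by rewrite powR_mulrn// real_normK ?num_real.
Qed.

Lemma L2fun_predP (f : T -> R[i]) : f \in L2fun_pred <->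
  (fun x => complex.Re (f x)) \in Lfun mu 2%:E /\
  (fun x => complex.Im (f x)) \in Lfun mu 2%:E.
Proof.
rewrite !Lfun2P inE /=.
have E : measurable_fun setT (fun x => complex.Re (f x)) ->
    measurable_fun setT (fun x => complex.Im (f x)) ->
    (\int[mu]_x (normc (f x) ^+ 2)%:E = \int[mu]_x (complex.Re (f x) ^+ 2)%:E
      + \int[mu]_x (complex.Im (f x) ^+ 2)%:E)%E.
  move=> mr mi; rewrite -ge0_integralD//.
  - by apply: eq_integral => x _; rewrite normc_sqr EFinD.
  - by move=> x _; rewrite lee_fin sqr_ge0.
  - by apply/measurable_EFinP; exact: measurable_funX.
  - by move=> x _; rewrite lee_fin sqr_ge0.
  - by apply/measurable_EFinP; exact: measurable_funX.
have re0 : (0 <= \int[mu]_x (complex.Re (f x) ^+ 2)%:E)%E.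
  by apply: integral_ge0 => x _; rewrite lee_fin sqr_ge0.
have im0 : (0 <= \int[mu]_x (complex.Im (f x) ^+ 2)%:E)%E.
  by apply: integral_ge0 => x _; rewrite lee_fin sqr_ge0.
split=> [[mr mi]|[[mr fr] [mi fi]]].
  rewrite E// => h; split; split=> //; apply: le_lt_trans h.
    by rewrite leeDl.
  by rewrite leeDr.
by split=> //; rewrite E// lte_add_pinfty.
Qed.

Lemma L2fun_submod_closed : submod_closed L2fun_pred.
Proof.
have [L0 LD] := Lfun_submod_closed mu (lee1n 2).
have LZ r h : h \in Lfun mu 2%:E -> r *: h \in Lfun mu 2%:E.
  by move=> hL; rewrite -[_ *: _]addr0; exact: LD.
split=> [|a f g /L2fun_predP[fr fi] /L2fun_predP[gr gi]].
  by apply/L2fun_predP; split; exact: L0.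
apply/L2fun_predP; split.
  rewrite (_ : (fun x => _) = complex.Re a *: (fun x => complex.Re (f x)) +
     ((- complex.Im a) *: (fun x => complex.Im (f x)) +
      (fun x => complex.Re (g x)))).
    by do 2!(apply: (LD) => //); exact: LZ.
  apply/funext => x; rewrite !fctE/=.
  by case: a (f x) (g x) => ? ? [? ?] [? ?]; rewrite /GRing.scale /=; ring.
rewrite (_ : (fun x => _) = complex.Re a *: (fun x => complex.Im (f x)) +
     (complex.Im a *: (fun x => complex.Re (f x)) +
      (fun x => complex.Im (g x)))).
  by do 2!(apply: (LD) => //); exact: LZ.
apply/funext => x; rewrite !fctE/=.
by case: a (f x) (g x) => ? ? [? ?] [? ?]; rewrite /GRing.scale /=; ring.
Qed.

HB.instance Definition _ :=
  GRing.isSubmodClosed.Build _ _ L2fun_pred L2fun_submod_closed.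

Record L2fun := MkL2fun {
  L2fun_val :> T -> R[i];
  L2funP : L2fun_val \in L2fun_pred
}.

HB.instance Definition _ := [isSub for L2fun_val].
HB.instance Definition _ := [Choice of L2fun by <:].
HB.instance Definition _ := [SubChoice_isSubLmodule of L2fun by <:].

Definition L2null : {pred L2fun} :=
  mem [set f : L2fun | {ae mu, forall x, f x = 0}].

Lemma L2null_submod_closed : submod_closed L2null.
Proof.
split=> [|a f g]; rewrite !inE/=; first by apply: aeW.
move=> f0 g0; apply: filterS2 f0 g0 => x fx gx.
by rewrite [LHS](_ : _ = a *: f x + g x)// fx gx scaler0 addr0.
Qed.

HB.instance Definition _ :=
  GRing.isSubmodClosed.Build _ _ L2null L2null_submod_closed.

Definition L2 : Type := Quotient.quot (GRing.ZmodClosed.clone _ L2null _).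
HB.instance Definition _ := Choice.on L2.
HB.instance Definition _ := EqQuotient.on L2.
HB.instance Definition _ := GRing.Zmodule.on L2.

Lemma L2_eqP (f g : L2fun) :
  \pi_L2 f = \pi_L2 g <-> {ae mu, forall x, f x = g x}.
Proof.
split.
  move=> /eqP; rewrite -Quotient.idealrBE inE/=.
  apply: filterS => x /=; rewrite !fctE => /eqP; rewrite subr_eq0 => /eqP//.
move=> fg; apply/eqP; rewrite -Quotient.idealrBE inE/=.
by apply: filterS fg => x /= fgx; rewrite !fctE fgx subrr.
Qed.

Lemma L2_reprP (f : L2fun) : {ae mu, forall x, repr (\pi_L2 f) x = f x}.
Proof. by apply/L2_eqP; rewrite reprK. Qed.

Definition cintegral (h : T -> R[i]) : R[i] :=
  ((\int[mu]_x complex.Re (h x)) +i* (\int[mu]_x complex.Im (h x)))%C.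

Definition L2fun_dot (f g : T -> R[i]) := cintegral (fun x => f x * (g x)^*%C).

Let cintegrable (h : T -> R[i]) :=
  mu.-integrable setT (EFin \o (fun x => complex.Re (h x))) /\
  mu.-integrable setT (EFin \o (fun x => complex.Im (h x))).

Let cintegrableM (f g : L2fun) : cintegrable (fun x => f x * (g x)^*%C).
Proof.
have /L2fun_predP[fr fi] := L2funP f; have /L2fun_predP[gr gi] := L2funP g.
have I u v : u \in Lfun mu 2%:E -> v \in Lfun mu 2%:E ->
    mu.-integrable setT (EFin \o (u \* v)).
  by move=> uL vL; apply/Lfun1_integrable/Lfun2_mul_Lfun1.
split.
- have := integrableD measurableT (I _ _ fr gr) (I _ _ fi gi).
  apply: eq_integrable => // x _ /=; rewrite -EFinD; congr EFin.
  by case: (f x) (g x) => ? ? [? ?] /=; ring.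
- have := integrableB measurableT (I _ _ fi gr) (I _ _ fr gi).
  apply: eq_integrable => // x _ /=; rewrite -EFinB; congr EFin.
  by case: (f x) (g x) => ? ? [? ?] /=; ring.
Qed.

Let cintegralP (a : R[i]) h k : cintegrable h -> cintegrable k ->
  cintegral (fun x => a * h x + k x) = a * cintegral h + cintegral k.
Proof.
move=> [hr hi] [kr ki].
have Z r u : mu.-integrable setT (EFin \o u) ->
    mu.-integrable setT (EFin \o (fun x => r * u x)).
  move=> iu; have := integrableZl measurableT r iu.
  by apply: eq_integrable => // x _ /=; rewrite EFinM.
have ZD r s u v : mu.-integrable setT (EFin \o u) ->
    mu.-integrable setT (EFin \o v) ->
    mu.-integrable setT (EFin \o (fun x => r * u x + s * v x)).
  move=> iu iv; have := integrableD measurableT (Z r _ iu) (Z s _ iv).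
  by apply: eq_integrable => // x _ /=; rewrite EFinD.
case: a => a b; rewrite /cintegral /=.
rewrite (_ : \int[mu]_x complex.Re _ = \int[mu]_x
    ((a * complex.Re (h x) + (- b) * complex.Im (h x)) + complex.Re (k x)));
  last by apply: eq_Rintegral => x _; case: (h x) (k x) => ? ? [? ?] /=; ring.
rewrite (_ : \int[mu]_x complex.Im _ = \int[mu]_x
    ((b * complex.Re (h x) + a * complex.Im (h x)) + complex.Im (k x)));
  last by apply: eq_Rintegral => x _; case: (h x) (k x) => ? ? [? ?] /=; ring.
rewrite !RintegralD ?RintegralZl//; try exact: ZD; try exact: Z.
by apply/eqP; rewrite eq_complex /=; apply/andP; split; apply/eqP; ring.
Qed.

Lemma L2fun_dotP (a : R[i]) (f g h : L2fun) :
  L2fun_dot (a *: f + g) h = a * L2fun_dot f h + L2fun_dot g h.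
Proof.
rewrite /L2fun_dot -cintegralP//.
by congr cintegral; apply/funext => x /=; rewrite !fctE /GRing.scale/=; ring.
Qed.

Lemma L2fun_dotC (f g : L2fun) : L2fun_dot f g = (L2fun_dot g f)^*%C.
Proof.
have [_ Ii] := cintegrableM g f.
rewrite /L2fun_dot /cintegral /=; congr (_ +i* _)%C.
  by apply: eq_Rintegral => x _; case: (f x) (g x) => ? ? [? ?] /=; ring.
rewrite -mulN1r -RintegralZl//.
by apply: eq_Rintegral => x _; case: (f x) (g x) => ? ? [? ?] /=; ring.
Qed.

Lemma L2fun_dot_null (f f' g : L2fun) : {ae mu, forall x, f x = f' x} ->
  L2fun_dot f g = L2fun_dot f' g.
Proof.
move=> ff'; have [fr fi] := cintegrableM f g.
have [fr' fi'] := cintegrableM f' g.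
congr (_ +i* _)%C; congr fine; apply: ae_eq_integral => //.
- exact: measurable_int fr.
- exact: measurable_int fr'.
- by apply: filterS ff' => x /= -> _.
- exact: measurable_int fi.
- exact: measurable_int fi'.
- by apply: filterS ff' => x /= -> _.
Qed.

Lemma L2fun_dotE (f : L2fun) :
  L2fun_dot f f = (\int[mu]_x (normc (f x) ^+ 2))%:C%C.
Proof.
congr (_ +i* _)%C.
  apply: eq_Rintegral => x _; rewrite normc_sqr.
  by case: (f x) => ? ? /=; ring.
rewrite (_ : \int[mu]_x _ = \int[mu]_x (0 : R)).
  by rewrite Rintegral_cst// mul0r.
by apply: eq_Rintegral => x _; case: (f x) => ? ? /=; ring.
Qed.

Lemma L2fun_dot_gt0 (f : L2fun) : f \notin L2null -> 0 < L2fun_dot f f.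
Proof.
have /[!inE]/= -[mr mi foo] := L2funP f.
have mf : measurable_fun setT (fun x => (normc (f x) ^+ 2)%:E).
  apply/measurable_EFinP; under eq_fun do rewrite normc_sqr.
  by apply: measurable_funD; exact: measurable_funX.
have f0 : (0 <= \int[mu]_x (normc (f x) ^+ 2)%:E)%E.
  by apply: integral_ge0 => x _; rewrite lee_fin sqr_ge0.
rewrite L2fun_dotE ltcR /Rintegral; apply: contraNT => /negP int0.
rewrite inE/=; have : (\int[mu]_x `|(normc (f x) ^+ 2)%:E|)%E = 0%E.
  under eq_integral do rewrite gee0_abs ?lee_fin ?sqr_ge0//.
  apply/eqP; rewrite eq_le f0 andbT leNgt; apply/negP => int_gt0.
  by apply: int0; rewrite fine_gt0// int_gt0.
move=> /(ae_eq_integral_abs mu measurableT mf); apply: filterS => x /(_ I)/= [].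
by move=> /eqP; rewrite sqrf_eq0 => /eqP /eq0_normc.
Qed.

Definition L2_dot (x y : L2) := L2fun_dot (repr x) (repr y).

(* L2_dot and L2_scale below, and later translation and modulation, are defined
   on representatives; the lemmas with suffix _pi say that the choice of the
   representatives is irrelevant. *)
Lemma L2_dot_pi (f g : L2fun) : L2_dot (\pi_L2 f) (\pi_L2 g) = L2fun_dot f g.
Proof.
rewrite /L2_dot (L2fun_dot_null _ (L2_reprP f)) L2fun_dotC.
by rewrite (L2fun_dot_null _ (L2_reprP g)) -L2fun_dotC.
Qed.

Lemma L2_piD (f g : L2fun) : \pi_L2 (f + g) = \pi_L2 f + \pi_L2 g.
Proof. by rewrite !piE. Qed.

Definition L2_scale (a : R[i]) (x : L2) : L2 := \pi_L2 (a *: repr x).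

Lemma L2_scale_pi a (f : L2fun) : L2_scale a (\pi_L2 f) = \pi_L2 (a *: f).
Proof.
apply/L2_eqP; apply: filterS (L2_reprP f) => x fx.
by rewrite /= !fctE fx.
Qed.

Let scaleA a b v : L2_scale a (L2_scale b v) = L2_scale (a * b) v.
Proof. by rewrite -[v]reprK (L2_scale_pi b) !L2_scale_pi scalerA. Qed.
Let scale1 : left_id 1 L2_scale.
Proof. by move=> v; rewrite -[v]reprK !L2_scale_pi scale1r. Qed.
Let scaleDr : right_distributive L2_scale +%R.
Proof.
move=> a u v; rewrite -[u]reprK -[v]reprK -L2_piD !L2_scale_pi -L2_piD.
by rewrite scalerDr.
Qed.
Let scaleDl v : {morph L2_scale^~ v: a b / a + b}.
Proof.
by move=> a b; rewrite -[v]reprK !L2_scale_pi -L2_piD scalerDl.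
Qed.
HB.instance Definition _ := GRing.Zmodule_isLmodule.Build R[i] L2
  scaleA scale1 scaleDr scaleDl.

Let L2_dotC x y : L2_dot x y = Num.conj (L2_dot y x).
Proof. exact: L2fun_dotC. Qed.

Let L2_dotP (y : L2) a : {morph L2_dot^~ y : u v / a *: u + v >-> a * u + v}.
Proof.
move=> u v; rewrite -[u]reprK -[v]reprK -[y]reprK.
rewrite [_ *: _](L2_scale_pi a) -L2_piD !L2_dot_pi.
exact: L2fun_dotP.
Qed.

Let L2_dot_bilinear : bilinear_for
  (GRing.Scale.Law.clone _ _ ( *%R ) _)
  (GRing.Scale.Law.clone _ _ (Num.conj \; *%R ) _) L2_dot.
Proof.
split=> [y a u v|y a u v]; first exact: L2_dotP.
by rewrite L2_dotC L2_dotP rmorphD rmorphM/= -!L2_dotC.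
Qed.
HB.instance Definition _ := bilinear_isBilinear.Build R[i] L2 L2 R[i]
  (GRing.Scale.Law.clone _ _ ( *%R ) _)
  (GRing.Scale.Law.clone _ _ (Num.conj \; *%R ) _) L2_dot L2_dot_bilinear.
Let L2_dot_herm (x y : L2) : L2_dot x y = (-1) ^+ false * Num.conj (L2_dot y x).
Proof. by rewrite expr0 mul1r; exact: L2fun_dotC. Qed.
HB.instance Definition _ :=
  isHermitianSesquilinear.Build R[i] L2 false Num.conj L2_dot L2_dot_herm.
Let L2_dot_gt0 (x : L2) : x != 0 -> 0 < L2_dot x x.
Proof.
rewrite -[x]reprK L2_dot_pi => x0; apply: L2fun_dot_gt0.
by rewrite -[repr x]subr0 Quotient.idealrBE raddf0.
Qed.
HB.instance Definition _ := isDotProduct.Build R[i] L2 L2_dot L2_dot_gt0.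

HB.instance Definition _ := Lmodule_isNormed.Build R[i] L2
  (ip_normD L2_dot) (ip_normZ L2_dot) (@ip_norm0_eq0 _ _ L2_dot).

Let L2_normE (x : L2) : `|x| ^+ 2 = L2_dot x x.
Proof. exact: sqrtCK. Qed.

HB.instance Definition _ :=
  NormedModule_isInnerProductSpace.Build R L2 L2_normE.

End L2fun.

Section time_frequency_shifts.
Context (R : realType).
Local Notation mu := (@lebesgue_measure R).
Implicit Type c : R.

Let shift c (x : measurableTypeR R) : measurableTypeR R := x - c.

Let mshift c : measurable_fun setT (shift c).
Proof. exact: measurable_funB. Qed.

HB.instance Definition _ c :=
  isMeasurableFun.Build _ _ _ _ (shift c) (mshift c).

Lemma lebesgue_measure_shift c (A : set (measurableTypeR R)) : measurable A ->
  pushforward mu (shift c) A = mu A.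
Proof.
move=> mA; apply/esym.
apply: (@lebesgue_measure_unique R (pushforward mu (shift c))) => //.
move=> _ [[x y] _ <-].
rewrite [RHS](_ : _ = mu `]x + c, y + c]%classic); last first.
  congr (mu _); apply/seteqP; split=> z /=;
  by rewrite /shift !in_itv/= ltrBrDr lerBlDr.
rewrite !lebesgue_measure_itv/= !lte_fin ltrD2r.
by case: ifPn => // _; rewrite -!EFinB; congr EFin; ring.
Qed.

(* T_c f (x) = f (x - c) *)
Lemma translate_subproof c (f : L2fun mu) :
  (fun x : R => f (x - c)) \in L2fun_pred mu.
Proof.
have /L2fun_memP[mr mi foo] := L2funP f.
apply/L2fun_memP; split.
- exact: (measurableT_comp mr (mshift c)).
- exact: (measurableT_comp mi (mshift c)).
have mf : measurable_fun setT (fun x => (normc (f x) ^+ 2)%:E).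
  apply/measurable_EFinP; under eq_fun do rewrite normc_sqr.
  by apply: measurable_funD; exact: measurable_funX.
have := @ge0_integral_pushforward _ _ _ _ R _ (mshift c) mu setT _
  measurableT mf (fun x _ => sqr_ge0 (normc (f x))).
rewrite preimage_setT => <-; apply: le_lt_trans foo.
rewrite le_eqVlt; apply/orP; left; apply/eqP.
apply: eq_measure_integral => A mA _.
exact: lebesgue_measure_shift.
Qed.

Definition translate c (f : L2fun mu) : L2fun mu :=
  MkL2fun (translate_subproof c f).

Definition translation c (f : L2 mu) : L2 mu :=
  \pi_(L2 mu) (translate c (repr f)).

Lemma translation_pi c (f : L2fun mu) :
  translation c (\pi_(L2 mu) f) = \pi_(L2 mu) (translate c f).
Proof.
apply/L2_eqP; have [N [mN N0 sN]] := L2_reprP f.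
exists (shift c @^-1` N); split.
- by rewrite -[X in measurable X]setTI; exact: mshift.
- by rewrite -[RHS]N0; exact: lebesgue_measure_shift.
- by move=> x /= fx; exact: sN.
Qed.

(* e^{it} *)
Definition expi (t : R) : R[i] := (cos t +i* sin t)%C.

(* E_c f (x) = e^{2 pi i c x} f (x) *)
Lemma modulate_subproof c (f : L2fun mu) :
  (fun x : R => expi (2 * pi * c * x) * f x) \in L2fun_pred mu.
Proof.
have /L2fun_memP[mr mi foo] := L2funP f.
have mlin : measurable_fun setT (fun x : R => 2 * pi * c * x).
  exact: measurable_funM.
have mcos : measurable_fun setT (fun x : R => cos (2 * pi * c * x)).
  apply: (measurableT_comp _ mlin).
  by apply: continuous_measurable_fun; exact: continuous_cos.
have msin : measurable_fun setT (fun x : R => sin (2 * pi * c * x)).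
  apply: (measurableT_comp _ mlin).
  by apply: continuous_measurable_fun; exact: continuous_sin.
apply/L2fun_memP; split.
- rewrite (_ : (fun x => _) = (fun x => cos (2 * pi * c * x) * complex.Re (f x)
     - sin (2 * pi * c * x) * complex.Im (f x))).
    by apply: measurable_funB; exact: measurable_funM.
  by apply/funext => x /=; case: (f x).
- rewrite (_ : (fun x => _) = (fun x => cos (2 * pi * c * x) * complex.Im (f x)
     + sin (2 * pi * c * x) * complex.Re (f x))).
    by apply: measurable_funD; exact: measurable_funM.
  by apply/funext => x /=; case: (f x).
- apply: le_lt_trans foo; rewrite le_eqVlt; apply/orP; left; apply/eqP.
  apply: eq_integral => x _.
  by rewrite normcM {1}/normc/= cos2Dsin2 sqrtr1 mul1r.
Qed.

Definition modulate c (f : L2fun mu) : L2fun mu :=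
  MkL2fun (modulate_subproof c f).

Definition modulation c (f : L2 mu) : L2 mu :=
  \pi_(L2 mu) (modulate c (repr f)).

Lemma modulation_pi c (f : L2fun mu) :
  modulation c (\pi_(L2 mu) f) = \pi_(L2 mu) (modulate c f).
Proof.
by apply/L2_eqP; apply: filterS (L2_reprP f) => x /= ->.
Qed.

(* E_{mb} T_{na} g, for k = (m, n) *)
Definition gabor (a b : R) (g : L2 mu) : int * int -> L2 mu :=
  fun k => modulation (k.1%:~R * b) (translation (k.2%:~R * a) g).

End time_frequency_shifts.

(* Main.v *)
(* Let U_k be the time-frequency shift attached to k, S the frame operator of
   G = (U_k g) and h = S^-1 g. Up to phases, which cancel in <f, U_k g> U_k g,
   each U_k permutes G, so it commutes with S; it also commutes with A. Hence
     <f, U_k A^* h> = <A f, S^-1 U_k g> = <S^-1 A f, U_k g>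
   and <f, U_k S gd> = <S f, U_k gd>, and synthesizing with G the coefficients
   of f with respect to (U_k gad) gives A f - S f + S f = A f.
   The invertibility of S needs the completeness of L^2 (Riesz-Fischer), through
   the fixed points of x |-> x - t (S x - y), a contraction for small t > 0. *)
Require Import Defs.
From HB Require Import structures.
From mathcomp Require Import all_boot all_order all_algebra complex finmap.
From mathcomp Require Import sesquilinear generic_quotient ring_quotient ring lra.
From mathcomp Require Import all_classical all_reals all_analysis.
From mathcomp Require Import measurable_realfun.
From mathcomp.analysis Require summability.

Set Implicit Arguments.
Unset Strict Implicit.
Unset Printing Implicit Defensive.
Import Order.TTheory GRing.Theory Num.Theory.
Import numFieldNormedType.Exports.
Import ComplexField.Normc.

Local Open Scope classical_set_scope.
Local Open Scope ring_scope.
Local Open Scope quotient_scope.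

(** * Hilbert spaces *)

(** [adjoint] and [frame_operator_inv] are choice-based definitions, which carry information only
    once suitable values are known to exist. So two existence facts must be established first: S is
    onto, and A^* h satisfies the adjoint identity. From then on S^-1 enters only through S (S^-1 y)
    = y and a norm bound. A second obstacle is that [gad] is just a vector, and the orbit of an
    arbitrary vector need not be a Bessel sequence. Yet the Bessel property of the new family is
    part of the conclusion and is required to make sense of its series. The coefficient formula of
    the overview provides it: it writes <f, U_k gad> with coefficients of S^-1 A f and f with
    respect to G, and of S f with respect to the dual frame. The argument up to the completeness of
    L^2 takes place in an abstract Hilbert space, with the U_k surjective isometries that commute
    with A and S. *)

#[short(type="hilbertType")]
HB.structure Definition Hilbert (R : realType) :=
  {H of InnerProductSpace R H & Complete H}.

Lemma normc_ge0 (R : realType) (z : R[i]) : 0 <= normc z.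
Proof. by case: z => ? ?; exact: sqrtr_ge0. Qed.

Lemma Re_le_normc (R : realType) (z : R[i]) : `|complex.Re z| <= normc z.
Proof.
case: z => x y /=; rewrite -sqrtr_sqr ler_wsqrtr//.
by rewrite lerDl sqr_ge0.
Qed.

Section hnorm.
Context (R : realType) (H : innerProductType R).
Implicit Types (x y z : H) (c : R[i]).

Lemma normr_hnorm x : `|x| = (hnorm x)%:C%C.
Proof. by rewrite /hnorm RRe_real// ger0_real. Qed.

Lemma normr_normc c : `|c| = (normc c)%:C%C.
Proof. by []. Qed.

Lemma hnorm_ge0 x : 0 <= hnorm x.
Proof. by have := normr_ge0 x; rewrite normr_hnorm lecR. Qed.

Lemma hnorm0 : hnorm (0 : H) = 0.
Proof. by rewrite /hnorm normr0. Qed.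

Lemma ler_hnormD x y : hnorm (x + y) <= hnorm x + hnorm y.
Proof. by rewrite -lecR rmorphD/= -!normr_hnorm ler_normD. Qed.

Lemma hnorm_opp x : hnorm (- x) = hnorm x.
Proof. by rewrite /hnorm normrN. Qed.

Lemma hnorm_distC x y : hnorm (x - y) = hnorm (y - x).
Proof. by rewrite -hnorm_opp opprB. Qed.

Lemma hnormZ c x : hnorm (c *: x) = normc c * hnorm x.
Proof.
apply: (@complexI R).
by rewrite rmorphM/= -!normr_hnorm -normr_normc normrZ.
Qed.

Lemma innerxx x : inner x x = (hnorm x ^+ 2)%:C%C.
Proof. by rewrite -inner_normE normr_hnorm rmorphXn. Qed.

Lemma innerC x y : inner y x = (inner x y)^*%C.
Proof. exact: dotC. Qed.

Lemma normc_innerC x y : normc (inner x y) = normc (inner y x).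
Proof. by rewrite (innerC y x); case: (inner y x) => u v /=; rewrite sqrrN. Qed.

Lemma inner_hnorm_le x y : normc (inner x y) <= hnorm x * hnorm y.
Proof.
rewrite -(@ler_pXn2r _ 2)// ?nnegrE ?mulr_ge0 ?hnorm_ge0 ?normc_ge0//.
have := dot_CauchySchwarz inner x y.
by rewrite !innerxx normr_normc -!rmorphXn -rmorphM/= lecR exprMn.
Qed.

(** Serves both the contraction estimate for S and the polarization argument for isometries. *)
Lemma hnormB_sqr x y : hnorm (x - y) ^+ 2 =
  hnorm x ^+ 2 - 2 * complex.Re (inner y x) + hnorm y ^+ 2.
Proof.
apply: (@complexI R); rewrite -innerxx linearBl !linearB/= !innerxx (innerC y x).
case: (inner y x) => u v.
by apply/eqP; rewrite eq_complex/=; apply/andP; split; apply/eqP; ring.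
Qed.

Lemma bounded_operator_pos (A : H -> H) : bounded_operator A ->
  exists2 M : R, 0 < M & forall x, hnorm (A x) <= M * hnorm x.
Proof.
move=> [M AM]; exists (`|M| + 1); first by rewrite ltr_wpDl.
move=> x; rewrite (le_trans (AM _))// ler_wpM2r ?hnorm_ge0//.
by rewrite ler_wpDr// ler_norm.
Qed.

End hnorm.

(** * Bessel sequences and synthesis *)

#[local] Existing Instance summability.totally_filter.

Lemma sum_fsubset (V : zmodType) (I : choiceType) (u : I -> V)
    (A B : {fset I}) :
  (A `<=` B)%fset ->
  \sum_(k <- B) u k = \sum_(k <- A) u k + \sum_(k <- (B `\` A)%fset) u k.
Proof.
move=> AB; rewrite (big_fsetID _ (mem A))/=; congr (_ + _).
  apply: eq_fbigl => i; rewrite !inE/=.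
  by apply/andP/idP => [[]//|iA]; rewrite (fsubsetP AB).
by apply: eq_fbigl => i; rewrite !inE/= andbC.
Qed.

Section bessel.
Context (R : realType) (H : innerProductType R) (I : countType).
Implicit Types (phi psi : I -> H) (c : I -> R[i]) (F : {fset I}).

(** Trades the extended-real supremum for real bounds on finite sums, the form in which all frame
    bounds are handled below. *)
Lemma coef_energy_leP phi (f : H) (B : R) :
  (coef_energy phi f <= B%:E)%E <->
  forall F, \sum_(k <- F) normc (inner f (phi k)) ^+ 2 <= B.
Proof.
split=> [fB F|FB].
  rewrite -lee_fin; apply: le_trans fB; rewrite -sumEFin.
  apply: ereal_sup_ubound; exists [set` F] => //.
  by rewrite fsbig_finite//= set_fsetK.
apply: ge_ereal_sup => _ [X [finX _] <-].
by rewrite fsbig_finite//= sumEFin lee_fin.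
Qed.

Lemma coef_energy_geP phi (f : H) (B : R) :
  (B%:E <= coef_energy phi f)%E ->
  forall C, (forall F, \sum_(k <- F) normc (inner f (phi k)) ^+ 2 <= C) ->
  B <= C.
Proof.
by move=> Bf C /coef_energy_leP fC; rewrite -lee_fin (le_trans Bf).
Qed.

Lemma besselP phi : bessel phi <-> exists2 M : R, 0 < M &
  forall f F, \sum_(k <- F) normc (inner f (phi k)) ^+ 2 <= M * hnorm f ^+ 2.
Proof.
split=> [[M [M0 phiM]]|[M M0 phiM]].
  by exists M => // f; apply/coef_energy_leP.
by exists M; split => // f; apply/coef_energy_leP.
Qed.

Lemma frame_bessel phi : frame phi -> bessel phi.
Proof.
by move=> [m [M [_ M0 phiM]]]; exists M; split => // f; case/andP: (phiM f).
Qed.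

Lemma inner_suml F (u : I -> H) y :
  inner (\sum_(k <- F) u k) y = \sum_(k <- F) inner (u k) y.
Proof. exact: linear_sumlz. Qed.

(** Duality: for the finite sum s, |s|^2 is the sum of the c_k <phi_k, s>, and the Bessel bound
    controls the <s, phi_k> by |s| itself. AM-GM with weight M then gives 2 |s|^2 <= M sum |c_k|^2 +
    |s|^2. *)
Lemma bessel_sum_le phi M F c : 0 < M ->
  (forall f, \sum_(k <- F) normc (inner f (phi k)) ^+ 2 <= M * hnorm f ^+ 2) ->
  hnorm (\sum_(k <- F) c k *: phi k) ^+ 2 <= M * \sum_(k <- F) normc (c k) ^+ 2.
Proof.
move=> M0 phiM; set s := \sum_(k <- F) _.
have ss : hnorm s ^+ 2 <= \sum_(k <- F) normc (c k) * normc (inner s (phi k)).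
  rewrite -lecR -innerxx {1}/s inner_suml.
  rewrite -[leLHS]ger0_norm; last first.
    by rewrite -inner_suml -/s innerxx lecR sqr_ge0.
  rewrite (le_trans (ler_norm_sum _ _ _))// rmorph_sum; apply: ler_sum => k _ /=.
  by rewrite linearZl_LR/= normrM !normr_normc -rmorphM/= lecR normc_innerC.
have /(_ s) := phiM.
set P := \sum_(k <- F) _ in ss *; set Q := \sum_(k <- F) _; set C := \sum_(k <- F) _.
move=> QM.
(* AM-GM: [2 |c| |d| <= M |c|^2 + |d|^2 / M] *)
have : 2 * P <= M * C + M^-1 * Q.
  rewrite /P /C /Q !mulr_sumr -big_split/=; apply: ler_sum => k _.
  set x := normc _; set y := normc _.
  have := sqr_ge0 (M * x - y); rewrite -(pmulr_rge0 _ (_ : 0 < M^-1)) ?invr_gt0//.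
  rewrite sqrrB exprMn mulrDr mulrBr.
  have -> : M^-1 * (M ^+ 2 * x ^+ 2) = M * x ^+ 2 by field; rewrite gt_eqF.
  have -> : M^-1 * (M * x * y *+ 2) = 2 * (x * y).
    by rewrite -mulr_natl; field; rewrite gt_eqF.
  lra.
have : M^-1 * Q <= hnorm s ^+ 2 by rewrite ler_pdivrMl.
lra.
Qed.

Definition l2_coef c :=
  exists B : R, forall F, \sum_(k <- F) normc (c k) ^+ 2 <= B.

Lemma partial_sumE (u : I -> H) F :
  summability.partial_sum u F = \sum_(k <- F) u k.
Proof. by rewrite /summability.partial_sum big_seq_fsetE. Qed.

Lemma analysis_l2 phi f : bessel phi -> l2_coef (analysis phi f).
Proof.
by move=> /besselP[M _ phiM]; exists (M * hnorm f ^+ 2); exact: phiM.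
Qed.

Lemma hnorm_ball (x y : H) (e : R) :
  ball x e%:C%C y <-> hnorm (x - y) < e.
Proof. by rewrite -ball_normE/= normr_hnorm ltcR. Qed.

(** A positive element of R[i] is real, so the radii can be taken in R. *)
Lemma hnorm_cvgP (T : Type) (G : set_system T) (u : T -> H) (x : H) :
  Filter G ->
  u @ G --> x <-> forall e : R, 0 < e -> \forall t \near G, hnorm (x - u t) < e.
Proof.
move=> FG; split=> [/cvgrPdist_lt ux e e0|ux].
  have e0' : 0 < e%:C%C by rewrite ltcR.
  by apply: filterS (ux _ e0') => t; rewrite normr_hnorm ltcR.
apply/cvgrPdist_lt => e e0; have er := gtr0_real e0.
rewrite -(RRe_real er) ltcR in e0.
by apply: filterS (ux _ e0) => t; rewrite normr_hnorm -{2}(RRe_real er) ltcR.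
Qed.
End bessel.

Section synthesis.
Context (R : realType) (H : hilbertType R) (I : countType).
Implicit Types (phi psi : I -> H) (c d : I -> R[i]) (F : {fset I}).

Lemma synthesis_cvg phi c : bessel phi -> l2_coef c ->
  summability.partial_sum (fun k => c k *: phi k) @ summability.totally
    --> synthesis phi c.
Proof.
move=> /besselP[M M0 phiM] [B cB].
apply: cauchy_cvg; apply: cauchy_exP => e e0.
have er := gtr0_real e0; rewrite -(RRe_real er) ltcR in e0.
set r := complex.Re e in e0 *.
pose S := [set x | exists F, x = \sum_(k <- F) normc (c k) ^+ 2].
have supS : has_sup S.
  split; first by exists (\sum_(k <- fset0) normc (c k) ^+ 2); exists fset0.
  by exists B => _ [F ->].
(* [F0] captures the supremum of the energies up to r^2 / M. Enlarging it adds terms of energy below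
   r^2 / M, hence of norm below r by [bessel_sum_le]. *)
have re0 : 0 < r ^+ 2 / M by rewrite divr_gt0// exprn_gt0.
have [_ [F0 ->] F0S] := sup_adherent re0 supS.
exists (summability.partial_sum (fun k => c k *: phi k) F0).
exists F0 => // F /= F0F; rewrite -(RRe_real er) -/r.
apply/hnorm_ball; rewrite hnorm_distC !partial_sumE.
rewrite (sum_fsubset _ F0F) addrC addKr.
rewrite -(@ltr_pXn2r _ 2)// ?nnegrE ?hnorm_ge0 1?ltW//.
rewrite (le_lt_trans (bessel_sum_le c M0 (fun f => phiM f _)))//.
rewrite -ltr_pdivlMl// [ltRHS]mulrC.
have : \sum_(k <- F) normc (c k) ^+ 2 <= sup S.
  by apply: sup_upper_bound => //; exists F.
rewrite (sum_fsubset _ F0F); move: F0S; set x := \sum_(k <- F0) _.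
set y := \sum_(k <- _) _.
set z := _ / _; lra.
Qed.
End synthesis.

Section synthesis_theory.
Context (R : realType) (H : hilbertType R) (I : countType).
Implicit Types (phi psi : I -> H) (c d : I -> R[i]) (F : {fset I}).

Lemma synthesis_lim phi c (y : H) :
  summability.partial_sum (fun k => c k *: phi k) @ summability.totally --> y ->
  synthesis phi c = y.
Proof. exact: cvg_lim. Qed.

Lemma synthesisD phi c d : bessel phi -> l2_coef c -> l2_coef d ->
  synthesis phi (fun k => c k + d k) = synthesis phi c + synthesis phi d.
Proof.
move=> bphi cl dl; apply: synthesis_lim.
apply: cvg_trans (cvgD (synthesis_cvg bphi cl) (synthesis_cvg bphi dl)).
apply: near_eq_cvg; apply: nearW => F.
rewrite /= !fctE !partial_sumE -big_split/=; apply: eq_bigr => k _.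
by rewrite scalerDl.
Qed.

Lemma l2_coefN c : l2_coef c -> l2_coef (fun k => - c k).
Proof.
move=> [B cB]; exists B => F; rewrite (le_trans _ (cB F))//.
by rewrite le_eqVlt; apply/orP; left; apply/eqP/eq_bigr => k _; rewrite normcN.
Qed.

Lemma l2_coefD c d : l2_coef c -> l2_coef d -> l2_coef (fun k => c k + d k).
Proof.
move=> [B cB] [C dC]; exists (2 * (B + C)) => F.
apply: le_trans (ler_wpM2l _ (lerD (cB F) (dC F))) => //.
rewrite -!big_split/= mulr_sumr; apply: ler_sum => k _.
apply: (@le_trans _ _ ((normc (c k) + normc (d k)) ^+ 2)).
  rewrite ler_pXn2r ?nnegrE ?normc_ge0 ?addr_ge0 ?normc_ge0//.
  exact: le_normcD.
have := sqr_ge0 (normc (c k) - normc (d k)).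
nra.
Qed.

Lemma synthesisN phi c : bessel phi -> l2_coef c ->
  synthesis phi (fun k => - c k) = - synthesis phi c.
Proof.
move=> bphi cl; apply: synthesis_lim.
apply: cvg_trans (cvgN (synthesis_cvg bphi cl)).
apply: near_eq_cvg; apply: nearW => F.
rewrite /= !fctE !partial_sumE -sumrN/=; apply: eq_bigr => k _.
by rewrite scaleNr.
Qed.

Lemma hnorm_linear_cvg (L : {linear H -> H}) (T : Type) (G : set_system T)
    (u : T -> H) (x : H) {FG : Filter G} : bounded_operator L ->
  u @ G --> x -> L (u t) @[t --> G] --> L x.
Proof.
move=> /bounded_operator_pos[M M0 LM] /hnorm_cvgP ux; apply/hnorm_cvgP => e e0.
have /ux : 0 < e / M by rewrite divr_gt0.
apply: filterS => t; rewrite ltr_pdivlMr// => xu.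
by rewrite -linearB/= (le_lt_trans (LM _))// mulrC.
Qed.

Lemma linear_synthesis (L : {linear H -> H}) phi c : bounded_operator L ->
  bessel phi -> l2_coef c -> L (synthesis phi c) = synthesis (L \o phi) c.
Proof.
move=> bL bphi cl; apply/esym/synthesis_lim.
rewrite (_ : summability.partial_sum _ =
    fun F => L (summability.partial_sum (fun k => c k *: phi k) F)).
  exact: hnorm_linear_cvg bL (synthesis_cvg bphi cl).
apply/funext => F; rewrite !partial_sumE linear_sum; apply: eq_bigr => k _.
by rewrite linearZ.
Qed.

Lemma inner_cvgl (T : Type) (G : set_system T) (u : T -> H) (x y : H)
    {FG : Filter G} : u @ G --> x ->
  forall e : R, 0 < e ->
  \forall t \near G, normc (inner x y - inner (u t) y) < e.
Proof.
move=> /hnorm_cvgP ux e e0.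
have y1 : 0 < hnorm y + 1 by rewrite ltr_wpDl ?hnorm_ge0.
have /ux : 0 < e / (hnorm y + 1) by rewrite divr_gt0.
apply: filterS => t; rewrite ltr_pdivlMr// => xu.
rewrite -linearBl/= (le_lt_trans (inner_hnorm_le _ _))// (le_lt_trans _ xu)//.
by rewrite ler_wpM2l ?hnorm_ge0// lerDl.
Qed.

Lemma inner_cvgr (T : Type) (G : set_system T) (u : T -> H) (x y : H)
    {FG : Filter G} : u @ G --> x ->
  forall e : R, 0 < e ->
  \forall t \near G, normc (inner y x - inner y (u t)) < e.
Proof.
move=> ux e e0; apply: filterS (inner_cvgl y ux e0) => t.
by rewrite -linearBl -linearBr/= normc_innerC.
Qed.

(** The partial sums of both sides over the same finite set are equal, and one finite set can be
    chosen that is good for both limits. With [psi] equal to [phi] this is the self-adjointness of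
    S. *)
Lemma synthesis_analysis_adjoint phi psi f h : bessel phi -> bessel psi ->
  inner (synthesis phi (analysis psi f)) h =
  inner f (synthesis psi (analysis phi h)).
Proof.
move=> bphi bpsi; apply/subr0_eq/eq0_normc/eqP.
rewrite eq_le; apply/andP; split; last exact: normc_ge0.
apply/ler_addgt0Pr => e e0; rewrite add0r.
have e20 : 0 < e / 2 by rewrite divr_gt0.
have /(_ _) Hl := inner_cvgl h (synthesis_cvg bphi (analysis_l2 f bpsi)) e20.
have /(_ _) Hr := inner_cvgr f (synthesis_cvg bpsi (analysis_l2 h bphi)) e20.
have [F [/=]] := filter_ex (filterI Hl Hr).
rewrite !partial_sumE inner_suml.
have -> : inner f (\sum_(k <- F) analysis phi h k *: psi k) =
    \sum_(k <- F) inner (analysis psi f k *: phi k) h.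
  rewrite linear_sumr; apply: eq_bigr => k _.
  rewrite linearZl_LR linearZr_LR/= /analysis.
  by rewrite -[Num.conj _]/(_^*%C) -innerC mulrC.
set x := inner (synthesis _ _) h; set y := inner f _; set s := \sum_(k <- F) _.
move=> xs sy; rewrite (_ : x - y = (x - s) - (y - s)); last by ring.
rewrite (le_trans (le_normcD _ _))// normcN.
by rewrite [leRHS]splitr ltW// ltrD.
Qed.

End synthesis_theory.

(** * Invertibility of the frame operator *)

Section fixed_point.
Context (R : realType) (H : hilbertType R).

Lemma hilbert_fixed_point (D : H -> H) (q : R) : 0 <= q < 1 ->
  (forall x y, hnorm (D x - D y) <= q * hnorm (x - y)) -> exists x, D x = x.
Proof.
move=> /andP[q0 q1] Dq; pose u n := iter n D 0.
(* With this [C], the bound on the n-th step is q^n (1 - q) C = (q^n - q^(n+1)) C, which telescopes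
   in [uD]. *)
pose C := hnorm (D 0 - 0) / (1 - q).
have C0 : 0 <= C by rewrite divr_ge0 ?hnorm_ge0// subr_ge0 ltW.
have uS n : hnorm (u n.+1 - u n) <= q ^+ n * ((1 - q) * C).
  elim: n => [|n IH].
    by rewrite expr0 mul1r /C mulrCA mulfV ?mulr1 ?gt_eqF// subr_gt0.
  by rewrite exprS -mulrA (le_trans (Dq _ _))// ler_wpM2l.
have uD n k : hnorm (u (n + k)%N - u n) <= (q ^+ n - q ^+ (n + k)) * C.
  elim: k => [|k IH]; first by rewrite addn0 !subrr hnorm0 mul0r.
  rewrite addnS -[X in X - _](subrK (u (n + k)%N)) -addrA.
  rewrite (le_trans (ler_hnormD _ _))// (le_trans (lerD (uS _) IH))//.
  by rewrite le_eqVlt; apply/orP; left; apply/eqP; rewrite exprS; ring.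
have qC : q ^+ n * C @[n --> \oo] --> (0 * C : R).
  by apply: cvgMl; apply: cvg_expr; rewrite ger0_norm.
have ucvg : cvg (u n @[n --> \oo]).
  apply: cauchy_cvg; apply: cauchy_exP => e e0.
  have er := gtr0_real e0; rewrite -(RRe_real er) ltcR in e0.
  rewrite mul0r in qC; have /cvgrPdist_lt/(_ _ e0)[N _ NC] := qC.
  exists (u N); exists N => // n /= Nn; rewrite -(RRe_real er).
  apply/hnorm_ball; rewrite hnorm_distC -(subnKC Nn) (le_lt_trans (uD _ _))//.
  apply: le_lt_trans (NC N (leqnn N)); rewrite sub0r normrN.
  rewrite (le_trans _ (ler_norm _))// ler_wpM2r// gerBl exprn_ge0//.
exists (lim (u n @[n --> \oo])); set x := lim _ in ucvg *.
apply/subr0_eq/eqP; rewrite -normr_eq0 normr_hnorm.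
suff -> : hnorm (D x - x) = 0 by [].
apply/eqP; rewrite eq_le hnorm_ge0 andbT; apply/ler_addgt0Pr => e e0; rewrite add0r.
have e20 : 0 < e / 2 by rewrite divr_gt0.
have /hnorm_cvgP/(_ _ e20)[N _ Nx] := ucvg.
rewrite (_ : D x - x = (D x - D (u N)) - (x - u N.+1)); last first.
  by rewrite opprB addrA subrK.
rewrite (le_trans (ler_hnormD _ _))// hnorm_opp [leRHS]splitr ltW// ltrD//.
  rewrite (le_lt_trans (Dq _ _))// (le_lt_trans _ (Nx N _))//=.
  by rewrite ler_piMl ?hnorm_ge0// ltW.
exact: Nx (leqnSn N).
Qed.
End fixed_point.

Section frame_operator.
Context (R : realType) (H : hilbertType R) (I : countType).
Implicit Types (phi psi : I -> H) (c d : I -> R[i]) (F : {fset I}).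

Lemma synthesis_hnorm_le phi M c B : 0 < M ->
  (forall f F, \sum_(k <- F) normc (inner f (phi k)) ^+ 2 <= M * hnorm f ^+ 2) ->
  (forall F, \sum_(k <- F) normc (c k) ^+ 2 <= B) ->
  hnorm (synthesis phi c) ^+ 2 <= M * B.
Proof.
move=> M0 phiM cB.
have B0 : 0 <= B by have := cB fset0; rewrite big_seq_fset0.
have MB0 : 0 <= M * B by rewrite mulr_ge0// ltW.
rewrite -[leRHS]sqr_sqrtr// ler_pXn2r ?nnegrE ?hnorm_ge0 ?sqrtr_ge0//.
apply/ler_addgt0Pr => e e0.
have bphi : bessel phi by apply/besselP; exists M.
have cl : l2_coef c by exists B.
have /hnorm_cvgP/(_ _ e0)/filter_ex[F] := synthesis_cvg bphi cl.
rewrite partial_sumE; set s := \sum_(k <- _) _ => se.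
rewrite -[synthesis _ _](subrK s) (le_trans (ler_hnormD _ _))//.
rewrite addrC lerD//; last exact: ltW.
rewrite -(@ler_pXn2r _ 2)// ?nnegrE ?hnorm_ge0 ?sqrtr_ge0// sqr_sqrtr//.
rewrite (le_trans (bessel_sum_le c M0 (fun f => phiM f _)))//.
by rewrite ler_wpM2l// ltW.
Qed.

Lemma frame_operator_hnorm_le phi M f : 0 < M ->
  (forall f F, \sum_(k <- F) normc (inner f (phi k)) ^+ 2 <= M * hnorm f ^+ 2) ->
  hnorm (frame_operator phi f) <= M * hnorm f.
Proof.
move=> M0 phiM; rewrite -(@ler_pXn2r _ 2)//; last 2 first.
- exact: hnorm_ge0.
- by rewrite nnegrE mulr_ge0 ?hnorm_ge0// ltW.
by rewrite exprMn expr2 -mulrA; apply: synthesis_hnorm_le => //; exact: phiM.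
Qed.

(** <S f, f> is the limit of the finite energies, which increase with the finite set. Combined with
    the lower frame bound m, this makes S coercive: m |f|^2 <= Re <S f, f>. *)
Lemma frame_operator_energy phi f F : bessel phi ->
  \sum_(k <- F) normc (inner f (phi k)) ^+ 2 <=
  complex.Re (inner (frame_operator phi f) f).
Proof.
move=> bphi; apply/ler_addgt0Pr => e e0.
have /(_ _) H1 := inner_cvgl f (synthesis_cvg bphi (analysis_l2 f bphi)) e0.
have H2 : \forall F' \near @summability.totally I, (F `<=` F')%fset by exists F.
have [F' [/=]] := filter_ex (filterI H1 H2).
rewrite partial_sumE inner_suml => lim_e FF'.
have E : \sum_(k <- F') inner (analysis phi f k *: phi k) f =
    (\sum_(k <- F') normc (inner f (phi k)) ^+ 2)%:C%C.
  rewrite rmorph_sum/=; apply: eq_bigr => k _.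
  rewrite linearZl_LR/= /analysis (innerC f (phi k)) normc_sqr.
  case: (inner f (phi k)) => u v; apply/eqP; rewrite eq_complex/=.
  by apply/andP; split; apply/eqP; ring.
have FF : \sum_(k <- F) normc (inner f (phi k)) ^+ 2 <=
    \sum_(k <- F') normc (inner f (phi k)) ^+ 2.
  by rewrite (sum_fsubset _ FF') lerDl sumr_ge0// => k _; rewrite sqr_ge0.
move: lim_e; rewrite E; set z := inner _ f; set s := \sum_(k <- F') _ in FF *.
move=> zs; rewrite (le_trans FF)// -lerBlDl.
rewrite (le_trans _ (ltW zs))// (le_trans _ (Re_le_normc _))//.
by case: z {zs} => u v /=; rewrite distrC ler_norm.
Qed.

Lemma frame_operatorB phi f h : bessel phi ->
  frame_operator phi (f - h) = frame_operator phi f - frame_operator phi h.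
Proof.
move=> bphi; rewrite /frame_operator -synthesisN//; last exact: analysis_l2.
rewrite -synthesisD//; last 2 first.
- exact: analysis_l2.
- by apply: l2_coefN; exact: analysis_l2.
by congr synthesis; apply/funext => k; rewrite /analysis linearBl.
Qed.

Lemma frame_operator_surj phi : frame phi ->
  forall y, exists x, frame_operator phi x = y.
Proof.
move=> fphi y; have bphi := frame_bessel fphi.
have [m [M [m0 M0 mM]]] := fphi.
(* The inequality m <= M can fail in the zero space. Raising the upper bound to M + m ensures m / N
   < 1 in every case. *)
pose N := M + m; have N0 : 0 < N by rewrite addr_gt0.
have phiN f F : \sum_(k <- F) normc (inner f (phi k)) ^+ 2 <= N * hnorm f ^+ 2.
  have /andP[_ /coef_energy_leP/(_ F)] := mM f => /le_trans; apply.
  by rewrite ler_wpM2r ?sqr_ge0// lerDl ltW.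
have phim f : m * hnorm f ^+ 2 <= complex.Re (inner (frame_operator phi f) f).
  have /andP[/coef_energy_geP + _] := mM f; apply => F.
  exact: frame_operator_energy.
(* Expanding the square gives |x - t S x|^2 <= (1 - 2 t m + t^2 N^2) |x|^2. This [t] minimizes the
   factor, and [Q] is the minimum. *)
pose t := m / N ^+ 2; pose Q := 1 - (m / N) ^+ 2.
have mN : 0 < m / N < 1 by rewrite divr_gt0//= ltr_pdivrMr// mul1r ltrDr.
have Q01 : 0 <= Q < 1.
  case/andP: mN => mN0 mN1; apply/andP; split; last by rewrite gtrBl exprn_gt0.
  by rewrite subr_ge0 exprn_ile1// ltW.
have t0 : 0 < t by rewrite divr_gt0// exprn_gt0.
have Sx x : hnorm (x - t%:C%C *: frame_operator phi x) ^+ 2 <= Q * hnorm x ^+ 2.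
  have nt : normc t%:C%C = t by rewrite /= expr0n addr0 sqrtr_sqr gtr0_norm.
  rewrite hnormB_sqr hnormZ nt linearZl_LR/= exprMn.
  have -> z : complex.Re (t%:C%C * z) = t * complex.Re z.
    by case: z => u v /=; rewrite mul0r subr0.
  have S2 : hnorm (frame_operator phi x) ^+ 2 <= N ^+ 2 * hnorm x ^+ 2.
    have SN := frame_operator_hnorm_le x N0 phiN.
    by rewrite -exprMn ler_pXn2r// nnegrE ?hnorm_ge0// mulr_ge0 ?hnorm_ge0// ltW.
  have -> : Q = 1 - 2 * t * m + t ^+ 2 * N ^+ 2.
    by rewrite /Q /t; field; rewrite gt_eqF.
  have := ler_wpM2l (ltW t0) (phim x).
  have := ler_wpM2l (sqr_ge0 t) S2.
  lra.
(* [Sx] bounds squared norms, hence the contraction factor sqrt Q. A fixed point satisfies t (S x -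
   y) = 0 with t > 0. *)
have [|x z|x Dx] := @hilbert_fixed_point R H
  (fun x => x - t%:C%C *: (frame_operator phi x - y)) (Num.sqrt Q).
- rewrite sqrtr_ge0/= -sqrtr1 ltr_sqrt//; by case/andP: Q01.
- rewrite (_ : _ - _ = (x - z) - t%:C%C *: frame_operator phi (x - z)); last first.
    rewrite frame_operatorB// !scalerBr !opprB.
    rewrite [_ - z in LHS]addrC addrACA; congr (_ + _).
    by rewrite addrC addrA subrK.
  rewrite -(@ler_pXn2r _ 2)// ?nnegrE ?mulr_ge0 ?hnorm_ge0 ?sqrtr_ge0//.
  by rewrite exprMn sqr_sqrtr//; case/andP: Q01.
exists x; apply/subr0_eq/eqP.
have /eqP := Dx; rewrite -subr_eq0 addrAC subrr sub0r oppr_eq0 scaler_eq0.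
by rewrite [t%:C%C == 0]eq_complex/= gt_eqF.
Qed.

End frame_operator.

Section frame_operator_theory.
Context (R : realType) (H : hilbertType R) (I : countType).
Implicit Types (phi psi : I -> H) (c d : I -> R[i]) (F : {fset I}).

(** Summation along finite subsets ignores order: F contains the preimage of F0 under s as soon as
    s(F) contains F0. *)
Lemma synthesis_reindex phi c (s : I -> I) : bijective s -> bessel phi ->
  l2_coef c -> synthesis (phi \o s) (c \o s) = synthesis phi c.
Proof.
move=> [t st ts] bphi cl; apply: synthesis_lim; apply/hnorm_cvgP => e e0.
have /hnorm_cvgP/(_ _ e0)[F0 _ F0e] := synthesis_cvg bphi cl.
exists [fset t i | i in F0]%fset => // F /= F0F.
suff : (F0 `<=` [fset s i | i in F])%fset.
  move=> /F0e/=; rewrite !partial_sumE big_imfset//= => i j _ _.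
  exact: (can_inj st).
apply/fsubsetP => i iF0; apply/imfsetP; exists (t i); last by rewrite ts.
by apply: (fsubsetP F0F); apply/imfsetP; exists i.
Qed.

Lemma isometry_bounded (V : {linear H -> H}) :
  (forall x y, inner (V x) (V y) = inner x y) -> bounded_operator V.
Proof.
move=> Vi; exists 1 => x; rewrite mul1r le_eqVlt; apply/orP; left.
rewrite -(@eqrXn2 _ 2) ?hnorm_ge0//; apply/eqP/(@complexI R).
by rewrite -!innerxx.
Qed.

Lemma frame_operator_commute phi (V : {linear H -> H}) (s : I -> I)
    (p : I -> R[i]) f : bessel phi ->
  (forall x y, inner (V x) (V y) = inner x y) ->
  bijective s -> (forall k, normc (p k) = 1) ->
  (forall k, phi (s k) = p k *: V (phi k)) ->
  frame_operator phi (V f) = V (frame_operator phi f).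
Proof.
move=> bphi Vi bs p1 phis.
rewrite /frame_operator linear_synthesis//; last 2 first.
- exact: isometry_bounded.
- exact: analysis_l2.
(* After reindexing, the k-th term on the left is <V f, p V phi_k> p V phi_k = |p|^2 <f, phi_k> V
   phi_k with p = [p k]. *)
rewrite -(synthesis_reindex bs)//; last exact: analysis_l2.
rewrite /synthesis; congr summability.sum; apply/funext => k /=.
rewrite /analysis phis linearZr_LR/= Vi scalerA; congr (_ *: _).
by rewrite mulrAC [_ * p k]mulrC -normCK normr_normc p1 expr1n mul1r.
Qed.

(** Moving A to the other side as A^* would be circular, since the existence of A^* is derived from
    this lemma. Instead, the energy s equals <f, A x>, where x is the sum of the c_k phi_k with c_k
    = <f, A phi_k>, and |x|^2 <= M s by [bessel_sum_le]. So s^2 <= |f|^2 L^2 M s, and s can be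
    cancelled when it is nonzero. *)
Lemma bessel_comp (A : {linear H -> H}) phi :
  bounded_operator A -> bessel phi -> bessel (A \o phi).
Proof.
move=> /bounded_operator_pos[L L0 AL] /besselP[M M0 phiM]; apply/besselP.
exists (L ^+ 2 * M); first by rewrite mulr_gt0// exprn_gt0.
move=> f F; set s := \sum_(k <- F) _.
have s0 : 0 <= s by apply: sumr_ge0 => k _; rewrite sqr_ge0.
pose c k := inner f (A (phi k)).
have sE : s%:C%C = inner f (A (\sum_(k <- F) c k *: phi k)).
  rewrite /s rmorph_sum linear_sum linear_sumr; apply: eq_bigr => k _ /=.
  by rewrite linearZ linearZr_LR/= -/(c k) mulrC -normCK normr_normc rmorphXn.
set t := hnorm (\sum_(k <- F) c k *: phi k).
have t2 : t ^+ 2 <= M * s by exact: bessel_sum_le.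
have st : s <= hnorm f * (L * t).
  have <- : normc s%:C%C = s by rewrite /= expr0n addr0 sqrtr_sqr ger0_norm.
  by rewrite sE (le_trans (inner_hnorm_le _ _))// ler_wpM2l ?hnorm_ge0.
have [->|sn0] := eqVneq s 0.
  by rewrite mulr_ge0 ?sqr_ge0// mulr_ge0 ?sqr_ge0// ltW.
have sp : 0 < s by rewrite lt_neqAle eq_sym sn0.
rewrite -(ler_pM2r sp) -expr2.
have : s ^+ 2 <= (hnorm f * (L * t)) ^+ 2.
  by rewrite ler_pXn2r// nnegrE !mulr_ge0 ?hnorm_ge0// ltW.
have : (hnorm f * L) ^+ 2 * t ^+ 2 <= (hnorm f * L) ^+ 2 * (M * s).
  by rewrite ler_wpM2l// sqr_ge0.
rewrite !exprMn; lra.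
Qed.

Lemma adjointE (A : H -> H) y z : (forall x, inner (A x) y = inner x z) ->
  forall x, inner (A x) y = inner x (adjoint A y).
Proof.
by move=> Az; rewrite /adjoint; case: xgetP => [w -> //|/(_ z)].
Qed.

(* Expanding x as the sum of the <x, psi k> phi k exhibits the adjoint, so that
   the Riesz representation theorem is not needed. *)
Lemma dual_frame_adjoint (A : {linear H -> H}) phi psi y : bounded_operator A ->
  bessel phi -> dual_frame phi psi ->
  forall x, inner (A x) y = inner x (adjoint A y).
Proof.
move=> bA bphi [fpsi dual]; have bpsi := frame_bessel fpsi.
(* The witness [z] stays open here and is fixed by the final unification: it is
   [synthesis psi (analysis (A \o phi) y)]. *)
apply: adjointE => x; rewrite {1}(dual x) linear_synthesis//; last exact: analysis_l2.
by apply: synthesis_analysis_adjoint => //; exact: bessel_comp.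
Qed.

Lemma frame_operator_invK phi : frame phi ->
  cancel (frame_operator_inv phi) (frame_operator phi).
Proof.
move=> fphi y; apply: pinvK; rewrite inE.
by have [x <-] := frame_operator_surj fphi y; exists x.
Qed.

(** Coercivity: with S x = y, m |x|^2 <= Re <y, x> <= |y| |x|. *)
Lemma frame_operator_inv_bounded phi : frame phi ->
  bounded_operator (frame_operator_inv phi).
Proof.
move=> fphi; have bphi := frame_bessel fphi; have [m [M [m0 M0 mM]]] := fphi.
exists m^-1 => y; set x := frame_operator_inv phi y.
have Sx : frame_operator phi x = y by exact: frame_operator_invK.
have mx : m * hnorm x ^+ 2 <= complex.Re (inner y x).
  have /andP[/coef_energy_geP + _] := mM x; apply => F.
  by rewrite -Sx; exact: frame_operator_energy.
have : m * hnorm x ^+ 2 <= hnorm y * hnorm x.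
  rewrite (le_trans mx)// (le_trans (ler_norm _))//.
  by rewrite (le_trans (Re_le_normc _))// inner_hnorm_le.
rewrite ler_pdivlMl// expr2 mulrA.
have [->|x0] := eqVneq (hnorm x) 0; first by rewrite !mulr0 hnorm_ge0.
by rewrite ler_pM2r// lt_neqAle eq_sym x0 hnorm_ge0.
Qed.

Lemma bounded_comp (A B : H -> H) :
  bounded_operator A -> bounded_operator B -> bounded_operator (A \o B).
Proof.
move=> /bounded_operator_pos[K K0 AK] [L BL]; exists (K * L) => x /=.
by rewrite (le_trans (AK _))// -mulrA ler_pM2l.
Qed.

Lemma bounded_frame_operator phi : bessel phi ->
  bounded_operator (frame_operator phi).
Proof.
by move=> /besselP[M M0 phiM]; exists M => f; exact: frame_operator_hnorm_le.
Qed.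

Lemma bessel_bounded phi (A : H -> H) : bessel phi -> bounded_operator A ->
  exists2 M : R, 0 < M &
  forall f F, \sum_(k <- F) normc (inner (A f) (phi k)) ^+ 2 <= M * hnorm f ^+ 2.
Proof.
move=> /besselP[M M0 phiM] /bounded_operator_pos[L L0 AL].
exists (M * L ^+ 2); first by rewrite mulr_gt0// exprn_gt0.
move=> f F; rewrite (le_trans (phiM _ _))// -mulrA ler_pM2l// -exprMn.
by rewrite ler_pXn2r// nnegrE ?hnorm_ge0// mulr_ge0 ?hnorm_ge0// ltW.
Qed.

(** Meant for u = S^-1 A and v = S. They are plain maps because boundedness is what has been proved
    of S^-1. The factor 3 comes from (x + y + z)^2 <= 3 (x^2 + y^2 + z^2). *)
Lemma bessel_analysis_sum phi psi theta (u v : H -> H) :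
  bessel phi -> bessel psi -> bounded_operator u -> bounded_operator v ->
  (forall f k, inner f (theta k) =
    inner (u f) (phi k) - inner f (phi k) + inner (v f) (psi k)) ->
  bessel theta.
Proof.
move=> bphi bpsi bu bv thetaE.
have [M1 M10 h1] := bessel_bounded bphi bu.
have [M2 M20 h2] := (besselP phi).1 bphi.
have [M3 M30 h3] := bessel_bounded bpsi bv.
apply/besselP; exists (3 * (M1 + M2 + M3)); first by rewrite mulr_gt0// !addr_gt0.
move=> f F; have := lerD (lerD (h1 f F) (h2 f F)) (h3 f F).
rewrite -!mulrDl -(ler_pM2l (_ : 0 < 3 :> R))// mulrA; apply: le_trans.
rewrite -!big_split/= mulr_sumr; apply: ler_sum => k _; rewrite thetaE.
set x := inner (u f) _; set y := inner f _; set z := inner (v f) _.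
apply: (@le_trans _ _ ((normc x + normc y + normc z) ^+ 2)).
  rewrite ler_pXn2r ?nnegrE ?normc_ge0 ?addr_ge0 ?normc_ge0//.
  rewrite (le_trans (le_normcD _ _))// lerD2r.
  by rewrite (le_trans (le_normcD _ _))// normcN.
have := sqr_ge0 (normc x - normc y); have := sqr_ge0 (normc y - normc z).
have := sqr_ge0 (normc x - normc z).
nra.
Qed.

Lemma approximate_dual_orbit (U : I -> {linear H -> H}) (g gd : H)
    (A : {linear H -> H}) :
  (forall k x y, inner (U k x) (U k y) = inner x y) ->
  (forall k y, exists x, U k x = y) ->
  (forall k x, A (U k x) = U k (A x)) ->
  let phi := fun k => U k g in let psi := fun k => U k gd in
  (forall k x, frame_operator phi (U k x) = U k (frame_operator phi x)) ->
  frame phi -> dual_frame phi psi -> bounded_operator A ->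
  let gad := adjoint A (frame_operator_inv phi g) - g + frame_operator phi gd in
  let theta := fun k => U k gad in
  bessel theta /\ forall f, synthesis phi (analysis theta f) = A f.
Proof.
move=> Ui Us AU phi psi SU fphi dpsi bA gad theta.
have bphi := frame_bessel fphi; have [fpsi dual] := dpsi.
have bpsi := frame_bessel fpsi.
pose S := frame_operator phi; pose Sinv := frame_operator_inv phi.
pose h := Sinv g.
have Sh : S h = g by exact: frame_operator_invK.
have Sadj x y : inner (S x) y = inner x (S y).
  exact: synthesis_analysis_adjoint.
have E1 f k : inner f (U k (adjoint A h)) = inner (Sinv (A f)) (phi k).
  (* Writing f = U_k x replaces the adjoint of U_k: <U_k x, U_k A^* h> = <A x, h> = <A f, U_k h>.
     Then A f = S (S^-1 A f), and S moves across to give S U_k h = U_k g. *)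
  have [x <-] := Us k f.
  rewrite Ui -(dual_frame_adjoint _ bA bphi dpsi) -(Ui k) -AU.
  rewrite -[in LHS](frame_operator_invK fphi (A (U k x))) -/S -/Sinv Sadj.
  by rewrite /S SU -/S Sh.
have thetaE f k : inner f (theta k) =
    inner (Sinv (A f)) (phi k) - inner f (phi k) + inner (S f) (psi k).
  by rewrite /theta /gad linearD linearB linearDr linearBr/= E1 Sadj /S SU.
have bSA : bounded_operator (Sinv \o A).
  by apply: bounded_comp => //; exact: frame_operator_inv_bounded.
split.
  apply: (bessel_analysis_sum bphi bpsi bSA (bounded_frame_operator bphi)).
  exact: thetaE.
move=> f.
have -> : analysis theta f = (fun k => (analysis phi (Sinv (A f)) k +
    - analysis phi f k) + analysis psi (S f) k).
  by apply/funext => k; rewrite /analysis thetaE.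
rewrite synthesisD//; last 2 first.
- by apply: l2_coefD; [|apply: l2_coefN]; exact: analysis_l2.
- exact: analysis_l2.
rewrite synthesisD ?synthesisN//; try exact: analysis_l2.
  by rewrite -dual [synthesis _ _]frame_operator_invK// subrK.
by apply: l2_coefN; exact: analysis_l2.
Qed.

End frame_operator_theory.

(** * Completeness of L2 *)

Section riesz_fischer.
Context d (T : measurableType d) (R : realType).
Variable mu : {measure set T -> \bar R}.

Section real_valued.
Variable u : nat -> T -> R.
Hypothesis mu_ : forall n, measurable_fun setT (u n).
Hypothesis u8 : forall n k, (n <= k)%N ->
  (\int[mu]_x ((u k x - u n x) ^+ 2)%:E <= (8^-1 ^+ n)%:E)%E.

Let msqr (v w : T -> R) : measurable_fun setT v -> measurable_fun setT w ->
  measurable_fun setT (fun x => ((v x - w x) ^+ 2)%:E).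
Proof.
move=> mv mw; apply/measurable_EFinP; apply: measurable_funX.
exact: measurable_funB.
Qed.

(* The weighted sum of the 4^n (u_(n+1) - u_n)^2 is integrable, hence almost
   everywhere finite, which makes u_(n+1) - u_n = O(2^-n) there. *)
Let rapid_cvg : {ae mu, forall x, cvgn (u ^~ x)}.
Proof.
pose w n x : \bar R := (4 ^+ n * (u n.+1 x - u n x) ^+ 2)%:E.
have w0 n x : (0 <= w n x)%E by rewrite lee_fin mulr_ge0// sqr_ge0.
have mw n : measurable_fun setT (w n).
  apply/measurable_EFinP; apply: measurable_funM => //.
  by apply/measurable_EFinP; exact: msqr.
pose W x := (\sum_(n <oo) w n x)%E.
have W0 x : (0 <= W x)%E by apply: nneseries_ge0.
have mW : measurable_fun setT W by apply: ge0_emeasurable_sum.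
have iW : mu.-integrable setT W.
  apply/integrableP; split => //.
  under eq_integral do rewrite gee0_abs//.
  rewrite integral_nneseries//.
  (* The n-th integral is at most 4^n 8^-n = 2 / 2^(n+1), and [epsilon_trick0] sums these bounds to
     2. *)
  apply: (@le_lt_trans _ _ 2%:E); last exact: ltry.
  apply: le_trans (epsilon_trick0 xpredT _) => //.
  apply: lee_nneseries => [n _ _|n _]; first exact: integral_ge0.
  rewrite /w; under eq_integral do rewrite EFinM.
  rewrite ge0_integralZl//; last 2 first.
  - exact: msqr.
  - by move=> x _; rewrite lee_fin sqr_ge0.
  apply: (@le_trans _ _ ((4 ^+ n)%:E * (8^-1 ^+ n)%:E)%E).
    rewrite lee_pmul// ?lee_fin// ?u8// integral_ge0// => x _.
    by rewrite lee_fin sqr_ge0.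
  rewrite -EFinM lee_fin -exprMn natrX exprS invfM mulrA mulfV// mul1r -exprVn.
  by rewrite le_eqVlt; apply/orP; left; apply/eqP; congr (_ ^+ _); field.
have := integrable_ae measurableT iW; apply: filterS => x /(_ I) Wfin.
pose r := Num.sqrt (fine (W x)).
have r0 : 0 <= r by exact: sqrtr_ge0.
have ur n : `|u n.+1 x - u n x| <= r * 2^-1 ^+ n.
  have : (w n x <= W x)%E.
    apply: le_trans (nneseries_lim_ge n.+1 (fun k _ _ => w0 k x)).
    by rewrite big_nat_recr//= leeDr// sume_ge0.
  rewrite -(fineK Wfin) lee_fin => wW.
  rewrite -(@ler_pXn2r _ 2)// ?nnegrE ?mulr_ge0// real_normK ?num_real//.
  rewrite exprMn sqr_sqrtr ?fine_ge0// -exprM mulnC exprM.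
  rewrite -(@ler_pM2l _ (4 ^+ n)) ?exprn_gt0//.
  rewrite [leRHS]mulrCA -exprMn (_ : 4 * 2^-1 ^+ 2 = 1); last by field.
  by rewrite expr1n mulr1.
have : cvgn (series (telescope (u ^~ x))).
  apply: normed_cvg; apply: (@series_le_cvg _ _ (geometric r 2^-1)) => //.
  - by move=> n; exact: normr_ge0.
  - by move=> n; rewrite mulr_ge0// exprn_ge0.
  - by apply: is_cvg_geometric_series; rewrite ger0_norm// invf_lt1// ltr1n.
rewrite telescopeK => ucvg.
rewrite (_ : u ^~ x = (fun n => (u n x - u 0 x) + u 0 x)); last first.
  by apply/funext => n; rewrite subrK.
by apply: is_cvgD => //; exact: is_cvg_cst.
Qed.

(** The upper limit is measurable everywhere and agrees with the limit almost everywhere; [fine]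
    sends its infinite values to 0. Fatou's lemma for (u_(n+k) - u_n)^2 as k grows then transfers
    the bound [u8] to v - u_n. *)
Lemma rapid_L2_cvg : exists2 v : T -> R, measurable_fun setT v &
  forall n, (\int[mu]_x ((v x - u n x) ^+ 2)%:E <= (8^-1 ^+ n)%:E)%E.
Proof.
pose v x := fine (limn_esup (fun n => (u n x)%:E)).
have mv : measurable_fun setT v.
  apply: (measurableT_comp (fine_measurable _)) => //.
  by apply: measurable_fun_limn_esup => n; exact/measurable_EFinP.
exists v => // n.
pose f k x := ((u (n + k)%N x - u n x) ^+ 2)%:E.
have mf k : measurable_fun setT (f k) by exact: msqr.
have f0 k x : (0 <= f k x)%E by rewrite lee_fin sqr_ge0.
have mliminf : measurable_fun setT (fun x => limn_einf (f ^~ x)).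
  rewrite /limn_einf; apply: measurableT_comp => //.
  by apply: measurable_fun_limn_esup => k; exact: measurableT_comp.
have liminf_ge0 x : (0 <= limn_einf (f ^~ x))%E.
  rewrite limn_einf_lim; apply: lime_ge; first exact: is_cvg_einfs.
  by apply: nearW => k; apply: le_ereal_inf_tmp => _ [m _ <-].
have -> : (\int[mu]_x ((v x - u n x) ^+ 2)%:E =
    \int[mu]_x limn_einf (f ^~ x))%E.
  apply: ge0_ae_eq_integral => //.
  - exact: msqr.
  - by move=> x _; rewrite lee_fin sqr_ge0.
  apply: filterS rapid_cvg => x ux _; apply/esym.
  have vx : u k x @[k --> \oo] --> v x.
    have uE : (u k x)%:E @[k --> \oo] --> (limn (u ^~ x))%:E.
      by apply: cvg_EFin => //; exact: nearW.
    by rewrite /v (cvg_limn_einf_sup uE).2.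
  have unx : u (n + k)%N x @[k --> \oo] --> v x.
    by under eq_cvg do rewrite addnC; move: vx; rewrite -(cvg_shiftn n).
  apply: (cvg_limn_einf_sup _).1; apply: cvg_EFin; first exact: nearW.
  rewrite [X in _ --> X]expr2 (_ : fine \o _ =
    (fun k => (u (n + k)%N x - u n x) * (u (n + k)%N x - u n x))).
    have uB : u (n + k)%N x - u n x @[k --> \oo] --> v x - u n x.
      by apply: cvgB => //; exact: cvg_cst.
    exact: (cvgM uB uB).
  by apply/funext => k.
apply: le_trans (fatou mu measurableT mf _) _ => //.
rewrite limn_einf_lim; apply: lime_le; first exact: is_cvg_einfs.
apply: nearW => k; apply: (@le_trans _ _ (\int[mu]_x f k x)%E).
  by apply: ereal_inf_lbound; exists k => //=.
by apply: u8; rewrite leq_addr.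
Qed.
End real_valued.

Lemma L2_piB (f g : L2fun mu) :
  \pi_(L2 mu) (f - g) = \pi_(L2 mu) f - \pi_(L2 mu) g.
Proof. by rewrite !piE. Qed.

Lemma L2_hnormE (f : L2fun mu) :
  ((hnorm (\pi_(L2 mu) f) ^+ 2)%:E = \int[mu]_x (normc (f x) ^+ 2)%:E)%E.
Proof.
have /L2fun_memP[_ _ foo] := L2funP f.
have f0 : (0 <= \int[mu]_x (normc (f x) ^+ 2)%:E)%E.
  by apply: integral_ge0 => x _; rewrite lee_fin sqr_ge0.
rewrite -[RHS]fineK; last by rewrite ge0_fin_numE.
congr EFin; apply: (@complexI R); rewrite -innerxx.
by rewrite [LHS](L2_dot_pi f f) L2fun_dotE.
Qed.

(** Completeness concerns Cauchy filters, so a sequence is extracted: x_n is the center of a ball of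
    radius r_n that belongs to F. Its limit, built from real and imaginary parts separately, is also
    the limit of F, since F contains these shrinking balls. *)
Lemma L2_complete (F : set_system (L2 mu)) :
  ProperFilter F -> cauchy F -> cvg F.
Proof.
move=> FF /cauchyP Fc.
(* For n <= k, a point common to both balls gives |x_k - x_n| <= r_k + r_n <= 4^-n, whose square
   16^-n is below the 8^-n required by [u8]. *)
pose r n : R := 2^-1 * 4^-1 ^+ n.
have r0 n : 0 < r n by rewrite mulr_gt0// ?exprn_gt0// invr_gt0.
have rc n : 0 < (r n)%:C%C by rewrite ltcR.
pose x n : L2 mu := projT1 (cid (Fc _ (rc n))).
have Fx n : F (ball (x n) (r n)%:C%C) by exact: projT2 (cid (Fc _ (rc n))).
pose f n : L2fun mu := repr (x n).
have r_le n k : (n <= k)%N -> r k <= r n.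
  move=> nk; rewrite ler_pM2l ?invr_gt0//.
  by apply: ler_wiXn2l => //; rewrite invf_le1// ler1n.
have xx n k : (n <= k)%N -> hnorm (x k - x n) ^+ 2 <= 8^-1 ^+ n.
  move=> nk.
  have [y [/hnorm_ball yk /hnorm_ball yn]] :=
    filter_ex (filterI (Fx k) (Fx n)).
  have xr : hnorm (x k - x n) <= 4^-1 ^+ n.
    rewrite (_ : x k - x n = (x k - y) - (x n - y)); last first.
      by rewrite opprB addrA subrK.
    rewrite (le_trans (ler_hnormD _ _))// hnorm_opp.
    rewrite (le_trans (lerD (ltW yk) (ltW yn)))//.
    rewrite (le_trans (lerD (r_le _ _ nk) (lexx _)))// /r -mulrDl.
    by rewrite (_ : 2^-1 + 2^-1 = 1) ?mul1r//; field.
  apply: (@le_trans _ _ ((4^-1 ^+ n) ^+ 2)).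
    by rewrite ler_pXn2r// nnegrE ?hnorm_ge0// exprn_ge0.
  by rewrite -exprM mulnC exprM; apply: lerXn2r; rewrite ?nnegrE//; lra.
have mre n : measurable_fun setT (fun t => complex.Re (f n t)).
  by have /L2fun_memP[] := L2funP (f n).
have mim n : measurable_fun setT (fun t => complex.Im (f n t)).
  by have /L2fun_memP[] := L2funP (f n).
have ff n k : (n <= k)%N ->
    (\int[mu]_t (normc (f k t - f n t) ^+ 2)%:E <= (8^-1 ^+ n)%:E)%E.
  move=> /xx; rewrite -lee_fin.
  by rewrite -[x k]reprK -[x n]reprK -L2_piB L2_hnormE.
have msub n k : measurable_fun setT (fun t => (normc (f k t - f n t) ^+ 2)%:E).
  apply/measurable_EFinP; under eq_fun do rewrite normc_sqr/= !raddfB/=.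
  by apply: measurable_funD; apply: measurable_funX; apply: measurable_funB.
have ffr n k : (n <= k)%N ->
   (\int[mu]_t ((complex.Re (f k t) - complex.Re (f n t)) ^+ 2)%:E
     <= (8^-1 ^+ n)%:E)%E.
  move=> /ff; apply: le_trans; apply: ge0_le_integral => //.
  - by move=> t _; rewrite lee_fin sqr_ge0.
  - apply/measurable_EFinP; apply: measurable_funX; exact: measurable_funB.
  - by move=> t _; rewrite lee_fin normc_sqr raddfB lerDl sqr_ge0.
have ffi n k : (n <= k)%N ->
   (\int[mu]_t ((complex.Im (f k t) - complex.Im (f n t)) ^+ 2)%:E
     <= (8^-1 ^+ n)%:E)%E.
  move=> /ff; apply: le_trans; apply: ge0_le_integral => //.
  - by move=> t _; rewrite lee_fin sqr_ge0.
  - apply/measurable_EFinP; apply: measurable_funX; exact: measurable_funB.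
  - move=> t _; rewrite lee_fin normc_sqr (raddfB (@complex.Im R)).
    by rewrite lerDr sqr_ge0.
have [v mv vf] := rapid_L2_cvg mre ffr.
have [w mw wf] := rapid_L2_cvg mim ffi.
pose h t : R[i] := (v t +i* w t)%C.
(* Each part of [h] is that of [f 0] plus a difference that is square-integrable by the estimate at
   n = 0. *)
have hL : h \in L2fun_pred mu.
  apply/L2fun_predP; have /L2fun_predP[fr fi] := L2funP (f 0).
  have LD := (Lfun_submod_closed mu (lee1n 2)).2 1.
  split=> /=.
    rewrite (_ : (fun x => v x) = 1 *: (fun t => v t - complex.Re (f 0 t)) +
      (fun t => complex.Re (f 0 t))).
      apply: LD => //; apply/Lfun2P; split; first exact: measurable_funB.
      by apply: le_lt_trans (vf 0) _; exact: ltry.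
    by apply/funext => t; rewrite !fctE scale1r subrK.
  rewrite (_ : (fun x => w x) = 1 *: (fun t => w t - complex.Im (f 0 t)) +
    (fun t => complex.Im (f 0 t))).
    apply: LD => //; apply/Lfun2P; split; first exact: measurable_funB.
    by apply: le_lt_trans (wf 0) _; exact: ltry.
  by apply/funext => t; rewrite !fctE scale1r subrK.
pose y : L2 mu := \pi_(L2 mu) (MkL2fun hL).
(* The two parts contribute 8^-n each to the squared norm, and 2 * 8^-n <= 4 * 4^-n. *)
have yx n : hnorm (y - x n) <= 2 * 2^-1 ^+ n.
  have : hnorm (y - x n) ^+ 2 <= 8^-1 ^+ n + 8^-1 ^+ n.
    rewrite -lee_fin -[x n]reprK -L2_piB L2_hnormE EFinD.
    apply: le_trans (leeD (vf n) (wf n)); rewrite -ge0_integralD//; last 4 first.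
    - by move=> t _; rewrite lee_fin sqr_ge0.
    - by apply/measurable_EFinP; apply: measurable_funX; exact: measurable_funB.
    - by move=> t _; rewrite lee_fin sqr_ge0.
    - by apply/measurable_EFinP; apply: measurable_funX; exact: measurable_funB.
    rewrite le_eqVlt; apply/orP; left; apply/eqP; apply: eq_integral => t _.
    rewrite normc_sqr -EFinD; congr (_ ^+ 2 + _ ^+ 2)%:E.
      by rewrite [LHS]raddfB.
    by rewrite [LHS](raddfB (@complex.Im R)).
  move=> h8; rewrite -(@ler_pXn2r _ 2)// ?nnegrE ?hnorm_ge0 ?mulr_ge0 ?exprn_ge0//.
  apply: (le_trans h8); rewrite exprMn -exprM mulnC exprM.
  have : 8^-1 ^+ n <= (2^-1 ^+ 2) ^+ n :> R.
    by apply: lerXn2r; rewrite ?nnegrE//; lra.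
  have : 0 <= (2^-1 ^+ 2) ^+ n :> R by rewrite !exprn_ge0.
  lra.
apply/cvg_ex; exists y; apply/cvg_ballP => e e0.
have er := gtr0_real e0; rewrite -(RRe_real er) ltcR in e0 *.
(* The 3 collects 2 * 2^-n from [yx] and the radius r_n <= 2^-n. *)
have h3 : 3 * 2^-1 ^+ n @[n --> \oo] --> (3 * 0 : R).
  by apply: cvgMr; apply: cvg_expr; rewrite ger0_norm// invf_lt1// ltr1n.
rewrite mulr0 in h3; have /cvgrPdist_lt/(_ _ e0)[N _ /(_ N (leqnn N))] := h3.
rewrite sub0r normrN => Ne; apply: filterS (Fx N) => z /hnorm_ball xz.
apply/hnorm_ball; apply: le_lt_trans Ne; rewrite ger0_norm ?mulr_ge0 ?exprn_ge0//.
rewrite (_ : y - z = (y - x N) + (x N - z)); last by rewrite addrA subrK.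
rewrite (le_trans (ler_hnormD _ _))// (le_trans (lerD (yx N) (ltW xz)))//.
have : r N <= 2^-1 ^+ N.
  rewrite /r -[leRHS]mul1r ler_pM ?exprn_ge0//; first by rewrite invf_le1// ler1n.
  by apply: lerXn2r; rewrite ?nnegrE//; lra.
lra.
Qed.

HB.instance Definition _ := Uniform_isComplete.Build (L2 mu) L2_complete.
End riesz_fischer.

(** * Time-frequency shifts *)

(** Polarization: norms of differences determine Re <x, y>, and Im <x, y> = Re <-i x, y>. *)
Lemma isometry_inner (R : realType) (H : innerProductType R)
    (V : {linear H -> H}) : (forall x, hnorm (V x) = hnorm x) ->
  forall x y, inner (V x) (V y) = inner x y.
Proof.
move=> Vi.
have ReV x y : complex.Re (inner (V x) (V y)) = complex.Re (inner x y).
  have := hnormB_sqr (V y) (V x); rewrite -linearB/= !Vi hnormB_sqr.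
  lra.
move=> x y; have := ReV (- 'i%C *: x) y; rewrite linearZ !linearZl_LR/=.
have := ReV x y; case: (inner (V x) _) (inner x y) => u v [u' v'] /= -> h.
by congr (_ +i* _)%C; move: h; lra.
Qed.

Section shifts.
Context (R : realType).
Local Notation mu := (@lebesgue_measure R).
Implicit Types (c e : R) (x y : L2 mu).

Lemma expiD c e : expi (c + e) = expi c * expi e.
Proof.
rewrite /expi cosD sinD; apply/eqP; rewrite eq_complex/=.
by apply/andP; split; apply/eqP; ring.
Qed.

Lemma expi0 : expi 0 = 1 :> R[i].
Proof. by rewrite /expi cos0 sin0. Qed.

Lemma normc_expi c : normc (expi c) = 1.
Proof. by rewrite /normc/= cos2Dsin2 sqrtr1. Qed.

Lemma eq_L2 (f h : L2fun mu) : f =1 h -> \pi_(L2 mu) f = \pi_(L2 mu) h.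
Proof. by move=> fh; apply/L2_eqP; apply: aeW. Qed.

Lemma L2_piZD (k : R[i]) (f h : L2fun mu) :
  \pi_(L2 mu) (k *: f + h) = k *: \pi_(L2 mu) f + \pi_(L2 mu) h.
Proof. by rewrite L2_piD -L2_scale_pi. Qed.

Lemma translation_linear c : linear (@translation R c).
Proof.
move=> k x y; rewrite -[x]reprK -[y]reprK -L2_piZD !translation_pi -L2_piZD.
exact: eq_L2.
Qed.

Lemma modulation_linear c : linear (@modulation R c).
Proof.
move=> k x y; rewrite -[x]reprK -[y]reprK -L2_piZD !modulation_pi -L2_piZD.
apply: eq_L2 => t /=; rewrite !fctE /= /GRing.scale/=; ring.
Qed.

HB.instance Definition _ c := GRing.isLinear.Build R[i] (L2 mu) (L2 mu) _
  (@translation R c) (translation_linear c).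
HB.instance Definition _ c := GRing.isLinear.Build R[i] (L2 mu) (L2 mu) _
  (@modulation R c) (modulation_linear c).

Lemma translationD c e x :
  translation (c + e) x = translation c (translation e x).
Proof.
rewrite -[x]reprK (translation_pi e) !translation_pi; apply: eq_L2 => t /=.
by rewrite opprD addrA.
Qed.

Lemma translation0 x : translation 0 x = x.
Proof.
rewrite -[x]reprK translation_pi; apply: eq_L2 => t /=.
by rewrite subr0.
Qed.

Lemma modulationD c e x :
  modulation (c + e) x = modulation c (modulation e x).
Proof.
rewrite -[x]reprK (modulation_pi e) !modulation_pi; apply: eq_L2 => t /=.
by rewrite mulrDr mulrDl expiD mulrA.
Qed.

Lemma modulation0 x : modulation 0 x = x.
Proof.
rewrite -[x]reprK modulation_pi; apply: eq_L2 => t /=.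
by rewrite mulr0 mul0r expi0 mul1r.
Qed.

Lemma modulation_translation c e x : modulation e (translation c x) =
  expi (2 * pi * e * c) *: translation c (modulation e x).
Proof.
rewrite -[x]reprK; set f := repr x.
rewrite (translation_pi c f) (modulation_pi e f) modulation_pi translation_pi.
rewrite [RHS](L2_scale_pi _ (translate c _)); apply: eq_L2 => t /=.
rewrite [RHS](_ : _ = expi (2 * pi * e * c) *
  (expi (2 * pi * e * (t - c)) * f (t - c)))//.
by rewrite mulrA -expiD -mulrDr [c + _]addrC subrK.
Qed.

Lemma hnorm_modulation c x : hnorm (modulation c x) = hnorm x.
Proof.
apply/eqP; rewrite -(@eqrXn2 _ 2) ?hnorm_ge0//; apply/eqP/EFin_inj.
rewrite -[x]reprK modulation_pi !L2_hnormE; apply: eq_integral => t _ /=.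
by rewrite normcM normc_expi mul1r.
Qed.

Lemma hnorm_translation c x : hnorm (translation c x) = hnorm x.
Proof.
apply/eqP; rewrite -(@eqrXn2 _ 2) ?hnorm_ge0//; apply/eqP/EFin_inj.
rewrite -[x]reprK translation_pi !L2_hnormE /=; set f := repr x.
have /L2fun_memP[mr mi _] := L2funP f.
have mf : measurable_fun setT (fun t => (normc (f t) ^+ 2)%:E).
  apply/measurable_EFinP; under eq_fun do rewrite normc_sqr.
  by apply: measurable_funD; exact: measurable_funX.
have mc : measurable_fun setT 
    (fun t : measurableTypeR R => t - c : measurableTypeR R).
  exact: measurable_funB.
have := @ge0_integral_pushforward _ _ _ _ R _ mc mu setT _
  measurableT mf (fun t _ => sqr_ge0 (normc (f t))).
rewrite preimage_setT => <-.
by apply: eq_measure_integral => B mB _; exact: lebesgue_measure_shift.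
Qed.

(** Applied to both modulations and translations. Induction on naturals is run for a general step
    [e], then used at c and at -c to cover both signs of m. *)
Lemma commute_mulrz (H : Type) (W : R -> H -> H) (A : H -> H) c :
  (forall e e' z, W (e + e') z = W e (W e' z)) -> (forall z, W 0 z = z) ->
  (forall z, A (W c z) = W c (A z)) ->
  (forall z, A (W (- c) z) = W (- c) (A z)) ->
  forall (m : int) z, A (W (m%:~R * c) z) = W (m%:~R * c) (A z).
Proof.
move=> WD W0 AW AWN.
have Wn e n z : (forall z, A (W e z) = W e (A z)) ->
    A (W (n%:R * e) z) = W (n%:R * e) (A z).
  move=> AWe; elim: n z => [|n IH] z; first by rewrite mul0r !W0.
  by rewrite mulrSr mulrDl mul1r !WD IH AWe.
case=> n z; first exact: Wn.
by rewrite NegzE mulrNz mulNr -mulrN; exact: Wn.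
Qed.

(** Packaged as a linear map so that [gabor a b g k] is convertible to its value at [g]. *)
Definition time_frequency_shift (a b : R) (k : int * int) :
    {linear L2 mu -> L2 mu} :=
  (@modulation R (k.1%:~R * b) \o @translation R (k.2%:~R * a)).

Lemma time_frequency_shift_inner a b k x y :
  inner (time_frequency_shift a b k x) (time_frequency_shift a b k y) =
  inner x y.
Proof.
rewrite /= (isometry_inner (hnorm_modulation _)).
exact: (isometry_inner (hnorm_translation _)).
Qed.

Lemma time_frequency_shift_surj a b k y :
  exists x, time_frequency_shift a b k x = y.
Proof.
exists (translation (- (k.2%:~R * a)) (modulation (- (k.1%:~R * b)) y)) => /=.
by rewrite -translationD subrr translation0 -modulationD subrr modulation0.
Qed.

(** The phase appears when the modulation of index k is moved past the translation of index l. Hence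
    the shift by l permutes the family through k |-> k + l, up to unimodular factors, as
    [frame_operator_commute] requires. *)
Lemma gabor_addr a b (x : L2 mu) (k l : int * int) : gabor a b x (k + l) =
  expi (2 * pi * (k.1%:~R * b) * (l.2%:~R * a)) *:
    time_frequency_shift a b l (gabor a b x k).
Proof.
rewrite /gabor /= !intrD [_ * b]mulrDl [_ * a]mulrDl.
rewrite [in modulation (_ + _)]addrC modulationD.
rewrite [in translation (_ + _)]addrC translationD modulation_translation.
by rewrite linearZ.
Qed.

Lemma frame_operator_gabor a b (g x : L2 mu) l : bessel (gabor a b g) ->
  frame_operator (gabor a b g) (time_frequency_shift a b l x) =
  time_frequency_shift a b l (frame_operator (gabor a b g) x).
Proof.
move=> bg; apply: (frame_operator_commute _ bg
  (time_frequency_shift_inner a b l) _ _ (fun k => gabor_addr a b g k l)).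
- by exists (fun k => k - l) => k; rewrite ?addrK ?subrK.
- by move=> k; exact: normc_expi.
Qed.

End shifts.

Theorem proposition3p5 (R : realType) (a b : R)
    (g gd : L2 (@lebesgue_measure R))
    (A : {linear L2 (@lebesgue_measure R) -> L2 (@lebesgue_measure R)}) :
  0 < a -> 0 < b ->
  frame (gabor a b g) ->
  dual_frame (gabor a b g) (gabor a b gd) ->
  bounded_operator A ->
  (opnorm (fun f => (f - A f)%R) < 1)%E ->
  (forall f, A (modulation b f) = modulation b (A f)) ->
  (forall f, A (modulation (- b) f) = modulation (- b) (A f)) ->
  (forall f, A (translation a f) = translation a (A f)) ->
  (forall f, A (translation (- a) f) = translation (- a) (A f)) ->
  let G := gabor a b g in
  let gad := adjoint A (frame_operator_inv G g) - g + frame_operator G gd in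
  let Gad := gabor a b gad in
  approximately_dual G Gad /\
  (forall f, synthesis G (analysis Gad f) = A f).
Proof.
move=> _ _ fG dG bA A1 AE AEN AT ATN G gad Gad.
have bG := frame_bessel fG.
have AU k x :
    A (time_frequency_shift a b k x) = time_frequency_shift a b k (A x).
  rewrite /= (commute_mulrz (@modulationD R) (@modulation0 R) AE AEN).
  by rewrite (commute_mulrz (@translationD R) (@translation0 R) AT ATN).
have [bGad synA] := approximate_dual_orbit (time_frequency_shift_inner a b)
  (time_frequency_shift_surj a b) AU
  (fun k x => frame_operator_gabor x k bG) fG dG bA.
split=> //; split=> //; left.
rewrite (_ : (fun f => _) = (fun f => f - A f))//.
by apply/funext => f; rewrite synA.
Qed.
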